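(* Consider Problem P3. For any fixed choice of policies $\Gamma^1,\dots,\Gamma^n$ of the peripheral sensors, an optimal policy of the coordinating sensor is given as $$U_{T^0}=\begin{cases}1&\text{if } \pi^0_{T^0}\le\alpha_{T^0}\\ 0&\text{if } \pi^0_{T^0}>\alpha_{T^0}\end{cases}$$ and, for $k=1,\dots,T^0-1$, $$U_k=\begin{cases}1&\text{if } \pi^0_k\le\alpha_k(Z^1_{1:k},\dots,Z^n_{1:k})\\ N&\text{if } \alpha_k(Z^1_{1:k},\dots,Z^n_{1:k})<\pi^0_k<\beta_k(Z^1_{1:k},\dots,Z^n_{1:k})\\ 0&\text{if } \pi^0_k\ge\beta_k(Z^1_{1:k},\dots,Z^n_{1:k})\end{cases}$$ where $0\le\alpha_k(Z^1_{1:k},\dots,Z^n_{1:k})\le\beta_k(Z^1_{1:k},\dots,Z^n_{1:k})\le1$ are thresholds that depend on the sequence of messages received from the peripheral sensors.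
   Context: **Model.** $H\in\{0,1\}$ is random with known prior $P(H=0)=p_0$, $P(H=1)=1-p_0$. There are $n$ peripheral sensors S1,…,S$n$ and a coordinating sensor S0. Sensor $i\in\{0,\dots,n\}$ has observations $Y^i_t$, $t=1,2,\dots$; given $H$, each has either a discrete distribution or a density. Given $H$, the observations at different sensors are independent and the observations at each sensor at different times are independent. $X_{1:t}$ denotes $X_1,\dots,X_t$; $b$ is a blank message (no transmission). **Peripheral sensors.** As long as it has not sent a final message, sensor $i\ge1$ chooses at time $t$ $Z^i_t=\gamma^i_t(Y^i_{1:t})\in\{0,1,b\}$; $\tau^i=\min\{t:Z^i_t\in\{0,1\}\}\le T^i<\infty$ (at time $T^i$ it must send $0$ or $1$ if it has not done so before). It sends a single final message. $\Gamma^i=(\gamma^i_1,\gamma^i_2,\dots)$. **Coordinating sensor.** S0 knows which sensor sent each message and at time $t$ (if not stopped) chooses $U_t=\gamma^0_t(Y^0_{1:t},Z^1_{1:t},\dots,Z^n_{1:t})\in\{0,1,N\}$, where $N$ means ''continue'' and $Z^i_{1:t}$ means $Z^i_{1:\tau^i}$ if $t>\tau^i$; $\tau^0=\min\{t:U_t\in\{0,1\}\}\le T^0<\infty$. $\Gamma^0=(\gamma^0_1,\gamma^0_2,\dots)$. For fixed peripheral policies, S0's belief is $\pi^0_t=P(H=0|Y^0_{1:t},Z^1_{1:t},\dots,Z^n_{1:t})$. **Problem P3.** Select $\Gamma^0,\Gamma^1,\dots,\Gamma^n$ to minimize $\mathbb{E}\{\sum_{i=0}^n c^i\tau^i+J(U_{\tau^0},H)\}$,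 where the $c^i$ are finite positive numbers, $0\le J\le L<\infty$, $J(0,1)>J(1,1)$, $J(1,0)>J(0,0)$. If $\alpha_k=\beta_k=\pi^0_k$, the first listed applicable case is used. *)

(* Defs.v *)
(* Libraries: MathComp and MathComp-Analysis. *)
From HB Require Import structures.
From mathcomp Require Import all_boot all_order all_algebra.
From mathcomp Require Import all_classical all_reals all_analysis.

Set Implicit Arguments.
Unset Strict Implicit.
Unset Printing Implicit Defensive.

Import Order.TTheory GRing.Theory Num.Theory.

Local Open Scope classical_set_scope.
Local Open Scope ring_scope.

(* Conventions.
   - The values 0 and 1 of H, of the messages and of the decisions are the
     booleans false and true; in [option bool], None is the blank message b
     of a peripheral sensor, resp. the decision N (continue) of the
     coordinating sensor.
   - Sensors are indexed by 'I_n.+1: [ord0] is the coordinating sensor S0 and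
     [lift ord0 j], for j : 'I_n, are the peripheral sensors.
   - Times are 1, 2, ...; nothing below depends on the components at time 0 of
     an observation process, of a policy or of a belief. *)

Section Laws.
Context {R : realType} {d : measure_display} {S : measurableType d}.

Definition discrete_law (Q : set S -> R) : Prop :=
  exists (x : nat -> S) (p : nat -> R), (forall k, 0 <= p k) /\
    forall A, measurable A ->
      (Q A)%:E = (\sum_(0 <= k <oo) (p k)%:E * \d_(x k) A)%E.

Definition density_law (mu : set S -> \bar R) (Q : set S -> R) : Prop :=
  exists f : S -> R, [/\ measurable_fun setT f, (forall y, 0 <= f y) &
    forall A, measurable A -> (Q A)%:E = (\int[mu]_(y in A) (f y)%:E)%E].

End Laws.

(* The first t in 1..N at which u is not None, and N.+1 if there is none. *)
Definition first_time (N : nat) (u : nat -> option bool) : nat :=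
  (find (fun t => isSome (u t)) (iota 1 N)).+1.

Section Observations.
Context {R : realType} {d : measure_display} {Omega : measurableType d}
  (P : probability Omega R) (H : {mfun Omega >-> bool}).

(* P(A | H = h); only meaningful when P(H = h) is nonzero. *)
Definition cprob (h : bool) (A : set Omega) : R :=
  fine (P (A `&` [set w | H w = h])) / fine (P [set w | H w = h]).

Context {n : nat} {dE : 'I_n.+1 -> measure_display}
  {E : forall i, measurableType (dE i)}
  (Y : forall i, nat -> {mfun Omega >-> E i}).

Definition obs (i : 'I_n.+1) (t : nat) (w : Omega) : t.-tuple (E i) :=
  [tuple Y i s.+1 w | s < t].

Definition discrete_or_density
    (mu : forall i, {sigma_finite_measure set (E i) -> \bar R}) : Prop :=
  forall h, P [set w | H w = h] <> 0%E -> forall i t, (0 < t)%N ->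
    let law (A : set (E i)) := cprob h (Y i t @^-1` A) in
    discrete_law law \/ density_law (mu i) law.

Definition cond_indep_sensors : Prop :=
  forall h, P [set w | H w = h] <> 0%E ->
  forall (t : nat) (B : forall i, set (t.-tuple (E i))),
    (forall i, measurable (B i)) ->
    cprob h [set w | forall i, B i (obs i t w)] =
    \prod_i cprob h [set w | B i (obs i t w)].

Definition cond_indep_times : Prop :=
  forall h, P [set w | H w = h] <> 0%E ->
  forall (i : 'I_n.+1) (t : nat) (B : 'I_t -> set (E i)),
    (forall s, measurable (B s)) ->
    cprob h [set w | forall s : 'I_t, B s (Y i s.+1 w)] =
    \prod_(s < t) cprob h [set w | B s (Y i s.+1 w)].

End Observations.

(* The message histories (Z^1_{1:t}, ..., Z^n_{1:t}): each sequence is cut off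
   after the final message of its sensor, see [received]. *)
Definition messages (n : nat) : Type := {ffun 'I_n -> seq (option bool)}.

Section Policies.
Context {n : nat} {dE : 'I_n.+1 -> measure_display}
  (E : forall i, measurableType (dE i)).

Definition peripheral_policy (j : 'I_n) : Type :=
  forall t : nat, t.-tuple (E (lift ord0 j)) -> option bool.

Definition coordinator_policy : Type :=
  forall t : nat, t.-tuple (E ord0) -> messages n -> option bool.

Definition belief_map (R : realType) : Type :=
  forall t : nat, t.-tuple (E ord0) -> messages n -> R.

Definition threshold_policy {R : realType} (pi : belief_map R) (T0 : nat)
    (aT : R) (alpha beta : nat -> messages n -> R) : coordinator_policy :=
  fun k y z =>
    if (k < T0)%N then
      if pi k y z <= alpha k z then Some true
      else if pi k y z < beta k z then None
      else Some false
    else if pi k y z <= aT then Some true else Some false.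

End Policies.

Section Problem.
Context {R : realType} {d : measure_display} {Omega : measurableType d}
  (P : probability Omega R) (H : {mfun Omega >-> bool})
  {n : nat} {dE : 'I_n.+1 -> measure_display}
  {E : forall i, measurableType (dE i)}
  (Y : forall i, nat -> {mfun Omega >-> E i})
  (T : 'I_n.+1 -> nat) (Gamma : forall j, peripheral_policy E j).

Definition message (j : 'I_n) (t : nat) (w : Omega) : option bool :=
  @Gamma j t (obs Y (lift ord0 j) t w).

Definition tau (j : 'I_n) (w : Omega) : nat :=
  first_time (T (lift ord0 j)) (fun t => message j t w).

Definition peripheral_admissible : Prop :=
  (forall j t u, (0 < t)%N -> measurable [set y | @Gamma j t y = u]) /\
  (forall j w, (tau j w <= T (lift ord0 j))%N).

Definition received (t : nat) (w : Omega) : messages n :=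
  [ffun j => [seq message j s w | s <- iota 1 (minn t (tau j w))]].

(* pi is a version of P(H = 0 | Y^0_{1:t}, Z^1_{1:t}, ..., Z^n_{1:t}), written
   as a function of the conditioning variables.  Since there are countably many
   z : messages n, the measurable sets of pairs (y, z) are those with measurable
   sections B z. *)
Definition is_belief (pi : belief_map E R) : Prop :=
  forall t, (0 < t)%N ->
  [/\ forall z, measurable_fun setT (fun y => pi t y z),
      P.-integrable setT
        (fun w => (pi t (obs Y ord0 t w) (received t w))%:E) &
      forall B : messages n -> set (t.-tuple (E ord0)),
        (forall z, measurable (B z)) ->
        (\int[P]_(w in [set w | B (received t w) (obs Y ord0 t w)])
           (pi t (obs Y ord0 t w) (received t w))%:E)%E =
        P [set w | H w = false /\ B (received t w) (obs Y ord0 t w)]].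

Definition decision (g : coordinator_policy E) (t : nat) (w : Omega) :
    option bool :=
  g t (obs Y ord0 t w) (received t w).

Definition tau0 (g : coordinator_policy E) (w : Omega) : nat :=
  first_time (T ord0) (fun t => decision g t w).

Definition coordinator_admissible (g : coordinator_policy E) : Prop :=
  (forall t z u, (0 < t)%N -> measurable [set y | g t y z = u]) /\
  (forall w, (tau0 g w <= T ord0)%N).

(* The default value of [odflt] is never used for an admissible g. *)
Definition total_cost (c : 'I_n.+1 -> R) (J : bool -> bool -> R)
    (g : coordinator_policy E) : \bar R :=
  expectation P (fun w =>
    c ord0 * (tau0 g w)%:R
    + \sum_(j < n) c (lift ord0 j) * (tau j w)%:R
    + J (odflt false (decision g (tau0 g w) w)) (H w)).

Definition coordinator_optimal (c : 'I_n.+1 -> R) (J : bool -> bool -> R)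
    (g : coordinator_policy E) : Prop :=
  coordinator_admissible g /\
  forall g', coordinator_admissible g' ->
    (total_cost c J g <= total_cost c J g')%E.

End Problem.

(* Main.v *)
Require Import Defs.
From HB Require Import structures.
From mathcomp Require Import all_boot all_order all_algebra.
From mathcomp Require Import all_classical all_reals all_analysis.
From mathcomp Require Import measurable_realfun.
From mathcomp Require Import ring lra.

Set Implicit Arguments.
Unset Strict Implicit.
Unset Printing Implicit Defensive.

Import Order.TTheory GRing.Theory Num.Theory.

Local Open Scope classical_set_scope.
Local Open Scope ring_scope.

(** At time k the coordinator either stops, at an expected cost that is affine in
    its belief p, or continues. Fix the messages z received so far. A way of
    continuing is a policy g for the later times together with the list y of the
    k observations that g remembers. Given the hypothesis H = h and z, the later
    observations of S0 and all later messages are independent of the first k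
    observations of S0. Hence this continuation has an expected cost A_h(g, y, z)
    that depends on the past through the remembered y alone ([conditional_cost]),
    and it costs p A_0 + (1 - p) A_1 to a coordinator with belief p. Continuing is
    worth the infimum of these affine functions of p over all continuations
    ([cost_pairs]), which involves z and p only; this is why the thresholds are
    functions of z.

    The beliefs at which deciding 1 is at least as good as deciding 0 and as every
    continuation form the set cut out of [0, 1] by affine inequalities. All of them
    hold at p = 0, where 1 is the correct decision, so that this set is an interval
    [0, alpha], closed because each inequality is ([chord_threshold]). By symmetry
    deciding 0 is best on an interval [beta, 1] ([stopping_thresholds]).

    Optimality is proved by backward induction on k ([stagewise_optimal_from]).
    The identity [integral_cost_from] rewrites the expected remaining cost of any
    policy, on any event known to S0 at time k, as the integral over that event of
    the stopping cost or of p A_0 + (1 - p) A_1, taken at the current belief p and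
    with the actual past observations as memory. It combines Fubini's theorem for
    the independent past and future ([integral_decoupling_eq]) with the defining
    property of the belief ([integral_joint_prob]). The comparison of two policies
    at time k thereby becomes a pointwise comparison at almost every outcome.

    The threshold policy takes the right action at time k; what remains is to
    compare its own continuation with the infimum above. For every z, nearly
    optimal continuations are chosen at the points of a finite grid of beliefs and
    pasted into a single policy that selects among them according to the belief at
    time k ([near_optimal_policy]). The infimum is Lipschitz in p, so this policy is
    within e of every other one, whatever e > 0; the induction hypothesis says that
    the threshold policy does at least as well from time k + 1 on. *)

(** * Functions with measurable fibers *)

Section Fibers.
Context {d : measure_display} {T : measurableType d}.

(** Measurability of a map into a discrete space: messages and decisions range
    over countable types, for which the fibers generate everything. *)
Definition fiber_measurable (C : Type) (f : T -> C) : Prop :=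
  forall c, measurable [set w | f w = c].

Lemma fiber_measurable_preimage (C : countType) (f : T -> C) (S : set C) :
  fiber_measurable f -> measurable (f @^-1` S).
Proof.
move=> mf.
have -> : f @^-1` S = \bigcup_(c in S) [set w | f w = c].
  by apply/seteqP; split => [w Sfw|w [c Sc /= ->]//]; exists (f w).
rewrite bigcup_mkcond; apply: countable_bigcupT_measurable => //.
by move=> c; case: ifPn.
Qed.

Lemma fiber_measurable_comp (C : countType) (C' : Type) (f : T -> C)
    (F : C -> C') :
  fiber_measurable f -> fiber_measurable (fun w => F (f w)).
Proof.
move=> mf c; exact: (fiber_measurable_preimage [set x | F x = c] mf).
Qed.

Lemma fiber_measurable_map (I : eqType) (C : Type) (s : seq I)
    (f : I -> T -> C) :
  (forall i, i \in s -> fiber_measurable (f i)) ->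
  fiber_measurable (fun w => [seq f i w | i <- s]).
Proof.
elim: s => [|i s IHs] mf c /=.
  by case: c => [|x c]; [rewrite (_ : [set _ | _] = setT)//; apply/seteqP; split
    |rewrite (_ : [set _ | _] = set0)//; apply/seteqP; split].
case: c => [|x c]; first by rewrite (_ : [set _ | _] = set0)//; apply/seteqP; split.
rewrite (_ : [set _ | _] =
    [set w | f i w = x] `&` [set w | [seq f i w | i <- s] = c]).
  apply: measurableI; first by apply: mf; rewrite mem_head.
  by apply: IHs => j js; apply: mf; rewrite in_cons js orbT.
by apply/seteqP; split => w /= [<- <-].
Qed.

Lemma fiber_measurable_cst (C : Type) (x : C) :
  fiber_measurable (fun _ : T => x).
Proof.
move=> c; have [xc|xc] := pselect (x = c).
  by rewrite (_ : [set _ | _] = setT)//; apply/seteqP; split.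
by rewrite (_ : [set _ | _] = set0)//; apply/seteqP; split.
Qed.

Lemma fiber_measurable_if (C : Type) (p : T -> bool) (f g : T -> C) :
  measurable_fun setT p -> fiber_measurable f -> fiber_measurable g ->
  fiber_measurable (fun w => if p w then f w else g w).
Proof.
move=> mp mf mg c.
have mpT : measurable [set w | p w].
  rewrite (_ : [set w | _] = p @^-1` [set true])//.
  by rewrite -[X in measurable X]setTI; exact: mp.
rewrite (_ : [set w | _] = ([set w | p w] `&` [set w | f w = c]) `|`
   (~` [set w | p w] `&` [set w | g w = c])).
  by apply: measurableU; apply: measurableI => //; exact: measurableC.
apply/seteqP; split => w /=; last by move=> [[-> //]|[/negP/negbTE -> //]].
by case: ifP => pw <-; [left|right; split].
Qed.

Lemma fiber_measurable_truncn {R : realType} (f : T -> R) :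
  measurable_fun setT f -> fiber_measurable (fun w => Num.truncn (f w)).
Proof.
move=> mf i.
have mge j : measurable [set x | (j <= Num.truncn (f x))%N].
  case: j => [|j]; first by rewrite (_ : [set _ | _] = setT)//; apply/seteqP; split.
  rewrite (_ : [set _ | _] = f @^-1` `[j.+1%:R, +oo[); last first.
    by apply/seteqP; split => x; rewrite /= in_itv /= andbT truncn_gt_nat.
  by rewrite -[X in measurable X]setTI; exact: mf.
rewrite (_ : [set x | _] = [set x | (i <= Num.truncn (f x))%N] `\`
    [set x | (i < Num.truncn (f x))%N]); first exact: measurableD.
apply/seteqP; split => x /=; first by move=> ->; rewrite leqnn ltnn.
by move=> [ix /negP]; rewrite -leqNgt => xi; apply/eqP; rewrite eqn_leq ix xi.
Qed.

(** Gluing along the countably many fibers of f: on each of them the function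
    agrees with a measurable one. *)
Lemma measurable_fun_fibers (C : countType) (d' : measure_display)
    (T' : measurableType d') (f : T -> C) (F : C -> T -> T') :
  fiber_measurable f -> (forall c, measurable_fun setT (F c)) ->
  measurable_fun setT (fun w => F (f w) w).
Proof.
move=> mf mF _ B mB; rewrite setTI.
have -> : (fun w => F (f w) w) @^-1` B =
    \bigcup_c ([set w | f w = c] `&` F c @^-1` B).
  by apply/seteqP; split => [w Bw|w [c _ [/= <-]]//]; exists (f w).
apply: countable_bigcupT_measurable => // c; apply: measurableI => //.
by rewrite -[X in measurable X]setTI; exact: mF.
Qed.

(** Two integrals, possibly for different measures, agree as soon as they agree
    on each fiber of a map with countably many values. *)
Lemma ge0_integral_fibers (R : realType) (m1 m2 : {measure set T -> \bar R})
    (C : countType) (Z : T -> C) (D : set T) (f g : T -> \bar R) :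
  fiber_measurable Z -> measurable D ->
  measurable_fun setT f -> measurable_fun setT g ->
  (forall w, 0 <= f w)%E -> (forall w, 0 <= g w)%E ->
  (forall z, \int[m1]_(w in D `&` [set w | Z w = z]) f w =
             \int[m2]_(w in D `&` [set w | Z w = z]) g w)%E ->
  (\int[m1]_(w in D) f w = \int[m2]_(w in D) g w)%E.
Proof.
move=> mZ mD mf mg f0 g0 fg.
pose F n := D `&` [set w | pickle (Z w) = n].
have DF : D = \bigcup_n F n.
  by apply/seteqP; split => [w Dw|w [n _ []//]]; exists (pickle (Z w)).
have mF n : measurable (F n).
  by apply: measurableI => //; exact: (fiber_measurable_comp pickle mZ).
have tF : trivIset setT F.
  apply/trivIsetP => i j _ _ /eqP ij; apply/seteqP; split => // w [[_ /= Zi] [_ /= Zj]].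
  by apply: ij; rewrite -Zi -Zj.
rewrite DF !ge0_integral_bigcup//.
- apply: eq_eseriesr => n _; rewrite /F.
  have [[z zn]|nz] := pselect (exists z : C, pickle z = n).
    rewrite (_ : [set w | _] = [set w | Z w = z]) ?fg//.
    apply/seteqP; split => w /= => [|->//].
    by rewrite -zn => /(pcan_inj pickleK).
  rewrite (_ : D `&` _ = set0) ?integral_set0//.
  by apply/seteqP; split => // w [_ /= Zw]; apply: nz; exists (Z w).
- exact: measurable_funTS.
- exact: measurable_funTS.
Qed.

End Fibers.

(** * Integrals: densities, image measures, decoupling *)

Section Density.
Local Open Scope ereal_scope.
Import HBNNSimple.

(** The formula defining the density rho on sets passes to simple functions by
    linearity and to nonnegative functions by monotone convergence. *)
Lemma ge0_integral_density {d : measure_display} {T : measurableType d}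
    {R : realType} (m1 m : {measure set T -> \bar R}) (rho : T -> R)
    (f : T -> \bar R) (D : set T) :
  measurable D -> measurable_fun setT rho -> (forall x, 0 <= rho x)%R ->
  measurable_fun setT f -> (forall x, 0 <= f x) ->
  (forall A, measurable A -> A `<=` D -> m1 A = \int[m]_(x in A) (rho x)%:E) ->
  \int[m1]_(x in D) f x = \int[m]_(x in D) (f x * (rho x)%:E).
Proof.
move=> mD mrho rho0 mf f0 m1E.
have mfD : measurable_fun D f by exact: measurable_funTS.
have mrhoD : measurable_fun D (EFin \o rho).
  exact/measurable_funTS/measurable_EFinP.
pose h := nnsfun_approx mD mfD.
have mh n : measurable_fun D (fun x => (h n x)%:E).
  exact/measurable_funTS/measurable_EFinP.
have h0 n x : 0 <= (h n x)%:E by rewrite lee_fin.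
have ndh x : {homo (fun n => (h n x)%:E) : a b / (a <= b)%N >-> a <= b}.
  by move=> a b ab; rewrite lee_fin; exact/lefP/nd_nnsfun_approx.
have cvgh x : D x -> (h n x)%:E @[n --> \oo] --> f x.
  by move=> Dx; apply: cvg_nnsfun_approx.
have -> : \int[m1]_(x in D) f x = limn (fun n => \int[m1]_(x in D) (h n x)%:E).
  rewrite -monotone_convergence//.
  by apply: eq_integral => x /[!inE] /cvgh Dx; apply/esym/cvg_lim.
have -> : \int[m]_(x in D) (f x * (rho x)%:E) =
    limn (fun n => \int[m]_(x in D) ((h n x)%:E * (rho x)%:E)).
  rewrite -monotone_convergence//.
  - apply: eq_integral => x /[!inE] /cvgh Dx; apply/esym/cvg_lim => //.
    exact: cvgeZr.
  - by move=> n; apply: emeasurable_funM.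
  - by move=> n x _; rewrite mule_ge0// lee_fin.
  - by move=> x _ a b ab; rewrite lee_wpmul2r ?lee_fin// -lee_fin ndh.
congr (limn _); apply/funext => n.
have indich r : measurable_fun D (fun x => (r * \1_(h n @^-1` [set r]) x)%:E).
  by apply: (measurable_comp measurableT) => //; exact: measurable_funM.
transitivity (\int[m1]_(x in D)
   (\sum_(y \in range (h n)) (y * \1_(h n @^-1` [set y]) x)%:E)).
  by apply: eq_integral => t tE; rewrite /= fimfunE -fsumEFin.
rewrite ge0_integral_fsum//; last by move=> y x Dx; exact: nnfun_muleindic_ge0.
transitivity (\int[m]_(x in D) (\sum_(y \in range (h n))
    (y * \1_(h n @^-1` [set y]) x)%:E * (rho x)%:E)); last first.
  under eq_integral => x xE.
    rewrite -ge0_mule_fsuml => [|y]; last exact: nnfun_muleindic_ge0.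
    rewrite fsumEFin // -(fimfunE _ x); over.
  by [].
rewrite ge0_integral_fsum//; last 2 first.
  - by move=> y; apply: emeasurable_funM.
  - by move=> y x Dx; apply: mule_ge0; [exact: nnfun_muleindic_ge0|rewrite lee_fin].
apply: eq_fsbigr => r rhn.
under [LHS]eq_integral do rewrite EFinM.
rewrite integralZl_indic_nnsfun => //.
under [RHS]eq_integral do rewrite EFinM -muleA.
rewrite ge0_integralZl//.
- under [in RHS]eq_integral do rewrite muleC.
  rewrite [in RHS](eq_integral ((EFin \o rho) \_ (h n @^-1` [set r]))); last first.
    by move=> x xE; rewrite epatch_indic.
  rewrite -[in RHS]integral_mkcondr integral_indic//.
  by rewrite setIC m1E.
- by apply: emeasurable_funM => //; apply/measurable_EFinP; exact: measurable_indic.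
- by move=> x Dx; rewrite mule_ge0// lee_fin.
- by move: rhn => /[!inE] -[x _ <-]; rewrite lee_fin.
Qed.

End Density.

Section Independence.
Local Open Scope ereal_scope.
Context {d : measure_display} {T : measurableType d} {R : realType}
  (m : {measure set T -> \bar R}) (m_fin : m setT < +oo).

(** Both sides of the product formula, multiplied by the total mass m setT so that
    m need not be a probability, are finite measures of A; they agree on a
    pi-system, hence on the sigma-algebra it generates. *)
Lemma factorization_generated (G : set (set T)) (B : set T) :
  G `<=` measurable -> setI_closed G -> G setT -> measurable B ->
  (forall A, G A -> m (A `&` B) * m setT = m A * m B) ->
  forall A, <<s G >> A -> m (A `&` B) * m setT = m A * m B.
Proof.
move=> mG IG GT mB GB A sA.
have fin A' : measurable A' -> m A' \is a fin_num.
  move=> mA'; rewrite ge0_fin_numE// (le_lt_trans _ m_fin)//.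
  by rewrite le_measure ?inE.
have r0 A' : (0 <= fine (m A'))%R by rewrite fine_ge0.
pose m1 := mscale (NngNum (r0 setT)) (mrestr m mB).
pose m2 := mscale (NngNum (r0 B)) m.
have m1E A' : m1 A' = m (A' `&` B) * m setT.
  by rewrite /m1 /mscale /mrestr/= fineK ?fin// muleC.
have m2E A' : m2 A' = m A' * m B.
  by rewrite /m2 /mscale/= fineK ?fin// muleC.
rewrite -m1E -m2E.
apply: (g_sigma_algebra_measure_unique G mG (fun=> setT)) => //.
- exact: bigcup_const.
- by move=> A' /GB; rewrite /= -m1E -m2E.
- move=> _; rewrite /= -/m1 m1E setTI ltey_eq.
  by rewrite fin_numM ?fin.
Qed.

Lemma factorization_generated2 (G1 G2 : set (set T)) :
  G1 `<=` measurable -> setI_closed G1 -> G1 setT ->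
  G2 `<=` measurable -> setI_closed G2 -> G2 setT ->
  (forall A B, G1 A -> G2 B -> m (A `&` B) * m setT = m A * m B) ->
  forall A B, <<s G1 >> A -> <<s G2 >> B -> m (A `&` B) * m setT = m A * m B.
Proof.
move=> mG1 IG1 G1T mG2 IG2 G2T G12 A B sA sB.
have sub G : G `<=` measurable -> <<s G >> `<=` @measurable _ T.
  by move=> mG; apply: smallest_sub => //; exact: sigma_algebra_measurable.
have mA := sub _ mG1 _ sA.
have {}sA : forall B, G2 B -> m (B `&` A) * m setT = m B * m A.
  move=> B' GB'; rewrite setIC [RHS]muleC.
  by apply: (factorization_generated mG1) => //; [exact: mG2|move=> *; exact: G12].
rewrite setIC [RHS]muleC; by apply: (factorization_generated mG2).
Qed.

End Independence.

(** A copy of [pushforward] along a bundled measurable function, on which the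
    structure of a finite measure can be declared. *)
Definition image_measure {d d' : measure_display} {T : measurableType d}
    {T' : measurableType d'} {R : realType}
    (m : {measure set T -> \bar R}) (f : {mfun T >-> T'}) :=
  pushforward m f.

Section ImageMeasure.
Local Open Scope ereal_scope.
Context {d d' : measure_display} {T : measurableType d}
  {T' : measurableType d'} {R : realType}
  (m : {measure set T -> \bar R}) (f : {mfun T >-> T'}).

Let image_measure0 : image_measure m f set0 = 0.
Proof. exact: measure0. Qed.

Let image_measure_ge0 A : 0 <= image_measure m f A.
Proof. exact: measure_ge0. Qed.

Let image_measure_sigma_additive : semi_sigma_additive (image_measure m f).
Proof. exact: measure_semi_sigma_additive. Qed.

HB.instance Definition _ := isMeasure.Build _ _ _ (image_measure m f)
  image_measure0 image_measure_ge0 image_measure_sigma_additive.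

End ImageMeasure.

Section FiniteImageMeasure.
Local Open Scope ereal_scope.
Context {d d' : measure_display} {T : measurableType d}
  {T' : measurableType d'} {R : realType}
  (m : {finite_measure set T -> \bar R}) (f : {mfun T >-> T'}).

Let image_measure_finite : fin_num_fun (image_measure m f).
Proof.
move=> A mA; apply: fin_num_measure.
by rewrite -[X in measurable X]setTI; exact: measurable_funP.
Qed.

HB.instance Definition _ := Measure_isFinite.Build _ _ _ (image_measure m f)
  image_measure_finite.

End FiniteImageMeasure.

Lemma muleI {R : realType} (a : \bar R) :
  a \is a fin_num -> (0 < a)%E -> injective (fun x => a * x)%E.
Proof.
move=> af a0 x y /= axy; apply/le_anti.
by rewrite -(lee_pmul2l af a0 x) -(lee_pmul2l af a0 y) axy lexx.
Qed.

Lemma addeI {R : realType} (a : \bar R) :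
  a \is a fin_num -> injective (fun x => a + x)%E.
Proof.
move=> af x y /(congr1 (fun u => u - a)%E) /=.
by rewrite (addeC a x) (addeC a y) !addeK.
Qed.

Section Decoupling.
Local Open Scope ereal_scope.
Context {d d1 d2 : measure_display} {T : measurableType d}
  {T1 : measurableType d1} {T2 : measurableType d2}
  {R : realType} (m : {finite_measure set T -> \bar R})
  (f1 : {mfun T >-> T1}) (f2 : {mfun T >-> T2}).

(** If f1 and f2 are independent, the image of m under (f1, f2) is, up to the
    total mass, the product of the two image measures; Tonelli's theorem for the
    product replaces the common outcome w by two separate ones. *)
Lemma integral_decoupling (phi : T1 * T2 -> \bar R) :
  (forall A B, measurable A -> measurable B ->
    m (f1 @^-1` A `&` f2 @^-1` B) * m setT = m (f1 @^-1` A) * m (f2 @^-1` B)) ->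
  measurable_fun setT phi -> (forall x, 0 <= phi x) ->
  m setT * \int[m]_w phi (f1 w, f2 w) =
  \int[m]_w \int[m]_w' phi (f1 w, f2 w').
Proof.
move=> f12 mphi phi0.
have mf12 : measurable_fun setT (fun w => (f1 w, f2 w)).
  exact: measurable_fun_pair.
have r0 : (0 <= fine (m setT))%R by rewrite fine_ge0.
pose f12' : {mfun T >-> (T1 * T2)%type} :=
  HB.pack (fun w => (f1 w, f2 w)) (isMeasurableFun.Build _ _ _ _ _ mf12).
pose m12 := mscale (NngNum r0) (image_measure m f12').
have m12E A : m12 A = m setT * m ((fun w => (f1 w, f2 w)) @^-1` A).
  by congr (_ * _); exact: fineK (fin_num_measure _ _ measurableT).
have prodE A : measurable A -> (image_measure m f1 \x image_measure m f2) A = m12 A.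
  apply: product_measure_unique => A1 A2 mA1 mA2.
  transitivity (m setT * m (f1 @^-1` A1 `&` f2 @^-1` A2)).
    exact: (m12E (A1 `*` A2)).
  by rewrite muleC f12.
transitivity (\int[m12]_x phi x).
  rewrite ge0_integral_mscale//; congr (_ * _).
    by rewrite -[LHS]fineK ?fin_num_measure.
  by rewrite ge0_integral_pushforward.
rewrite (eq_measure_integral (image_measure m f1 \x image_measure m f2)); last first.
  by move=> A mA _; apply/esym; exact: prodE.
rewrite fubini_tonelli1// ge0_integral_pushforward//.
- apply: eq_integral => w _ /=; rewrite /fubini_F.
  rewrite ge0_integral_pushforward//.
  exact: measurableT_comp.
- exact: measurable_fun_fubini_tonelli_F.
- by move=> x _; exact: integral_ge0.
Qed.

Lemma measurable_integral_section (phi : T1 * T2 -> \bar R) :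
  measurable_fun setT phi -> (forall x, 0 <= phi x) ->
  measurable_fun setT (fun x => \int[m]_w phi (x, f2 w)).
Proof.
move=> mphi phi0.
have := measurable_fun_fubini_tonelli_F (m2 := image_measure m f2) phi mphi phi0.
congr (measurable_fun _ _); apply/funext => x; rewrite /fubini_F.
rewrite ge0_integral_pushforward//.
exact: measurableT_comp.
Qed.

(** Averaging over the second component alone does not change the integral:
    on an event that constrains f1 and f2 separately, phi may be replaced by any
    psi with the same partial integrals. *)
Lemma integral_decoupling_eq (B : set T1) (S : set T2)
    (phi psi : T1 * T2 -> \bar R) :
  (forall A B, measurable A -> measurable B ->
    m (f1 @^-1` A `&` f2 @^-1` B) * m setT = m (f1 @^-1` A) * m (f2 @^-1` B)) ->
  measurable B -> measurable S ->
  measurable_fun setT phi -> (forall x, 0 <= phi x) ->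
  measurable_fun setT psi -> (forall x, 0 <= psi x) ->
  (forall x, \int[m]_(w in f2 @^-1` S) phi (x, f2 w) =
             \int[m]_(w in f2 @^-1` S) psi (x, f2 w)) ->
  \int[m]_(w in f1 @^-1` B `&` f2 @^-1` S) phi (f1 w, f2 w) =
  \int[m]_(w in f1 @^-1` B `&` f2 @^-1` S) psi (f1 w, f2 w).
Proof.
move=> f12 mB mS mphi phi0 mpsi psi0 phipsi.
have [m0|mT0] := eqVneq (m setT) 0.
  have mz A : measurable A -> m A = mzero A.
    by move=> mA; apply: (subset_measure0 _ _ _ m0).
  have int0 D f : \int[m]_(w in D) f w = 0.
    transitivity (\int[mzero]_(w in D) f w); last exact: integral_measure_zero.
    by apply: eq_measure_integral => A mA _; exact: mz.
  by rewrite !int0.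
have mT : 0 < m setT by rewrite lt0e mT0 measure_ge0.
(* Restriction to B x S turns the integral over the event into a full one. *)
pose cut (f : T1 * T2 -> \bar R) := f \_ (B `*` S).
have mcut f : measurable_fun setT f -> measurable_fun setT (cut f).
  move=> mf; apply/(measurable_restrictT _ _).1; last exact: measurable_funTS.
  exact: measurableX.
have cut0 f : (forall x, 0 <= f x) -> forall x, 0 <= cut f x.
  by move=> f0 x; apply: erestrict_ge0.
have intE f : (forall x, 0 <= f x) -> measurable_fun setT f ->
    m setT * \int[m]_(w in f1 @^-1` B `&` f2 @^-1` S) f (f1 w, f2 w) =
    \int[m]_(w in f1 @^-1` B) \int[m]_(w' in f2 @^-1` S) f (f1 w, f2 w').
  move=> f0 mf; rewrite integral_mkcond.
  rewrite (_ : _ \_ _ = fun w => cut f (f1 w, f2 w)); last first.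
    apply/funext => w; rewrite /cut !patchE.
    by congr (if _ then _ else _); apply/idP/idP; rewrite !inE => -[].
  rewrite integral_decoupling//; [|exact: mcut|exact: cut0].
  rewrite [RHS]integral_mkcond; apply: eq_integral => w _.
  rewrite patchE; have [wB|wB] := boolP (w \in f1 @^-1` B).
    rewrite [RHS]integral_mkcond; apply: eq_integral => w' _.
    rewrite /cut !patchE; congr (if _ then _ else _).
    by move: wB; rewrite inE => Bw; apply/idP/idP; rewrite !inE; [case|split].
  rewrite integral0_eq// => w' _; rewrite /cut patchE ifF//.
  by apply/negbTE; apply: contra wB; rewrite !inE => -[].
have mTf : m setT \is a fin_num by exact: fin_num_measure.
have E : m setT * \int[m]_(w in f1 @^-1` B `&` f2 @^-1` S) phi (f1 w, f2 w) =
    m setT * \int[m]_(w in f1 @^-1` B `&` f2 @^-1` S) psi (f1 w, f2 w).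
  transitivity (\int[m]_(w in f1 @^-1` B) \int[m]_(w' in f2 @^-1` S) phi (f1 w, f2 w')).
    exact: intE.
  transitivity (\int[m]_(w in f1 @^-1` B) \int[m]_(w' in f2 @^-1` S) psi (f1 w, f2 w')).
    by apply: eq_integral => w _; exact: phipsi.
  by apply/esym; exact: intE.
exact: muleI mTf mT _ _ E.
Qed.

End Decoupling.

Section MoreIntegrals.
Local Open Scope ereal_scope.
Context {d d1 : measure_display} {T : measurableType d}
  {T1 : measurableType d1} {R : realType}.

Lemma ge0_integral_mrestr (m : {measure set T -> \bar R}) (A D : set T)
    (mD : measurable D) (f : T -> \bar R) :
  measurable A -> measurable_fun setT f -> (forall x, 0 <= f x) ->
  \int[mrestr m mD]_(x in A) f x = \int[m]_(x in A `&` D) f x.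
Proof.
move=> mA mf f0.
rewrite [LHS](ge0_integral_density (rho := \1_D) (m := m)) //; last first.
  by move=> B mB _; rewrite integral_indic// setIC.
rewrite integral_mkcondr; apply: eq_integral => x _.
by rewrite epatch_indic.
Qed.

Lemma ge0_integral_density_comp (m1 m : {measure set T -> \bar R})
    (X : {mfun T >-> T1}) (rho : T1 -> R) (f : T1 -> \bar R) (D : set T1) :
  measurable D -> measurable_fun setT rho -> (forall x, 0 <= rho x)%R ->
  measurable_fun setT f -> (forall x, 0 <= f x) ->
  (forall A, measurable A -> A `<=` D ->
    m1 (X @^-1` A) = \int[m]_(w in X @^-1` A) (rho (X w))%:E) ->
  \int[m1]_(w in X @^-1` D) f (X w) =
  \int[m]_(w in X @^-1` D) (f (X w) * (rho (X w))%:E).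
Proof.
move=> mD mrho rho0 mf f0 m1E.
have mfrho : measurable_fun setT (fun x => f x * (rho x)%:E).
  by apply: emeasurable_funM => //; exact/measurable_EFinP.
have frho0 x : 0 <= f x * (rho x)%:E by rewrite mule_ge0// lee_fin.
transitivity (\int[image_measure m1 X]_(x in D) f x).
  by rewrite [RHS]ge0_integral_pushforward//; exact: measurable_funTS.
rewrite (ge0_integral_density (rho := rho) (m := image_measure m X))//.
  by rewrite [LHS]ge0_integral_pushforward//; exact: measurable_funTS.
move=> A mA AD; rewrite [RHS]ge0_integral_pushforward//.
- exact: m1E.
- by apply: measurable_funTS; exact/measurable_EFinP.
- by move=> x _; rewrite lee_fin.
Qed.

Lemma null_of_integral_le0 (m : {measure set T -> \bar R})
    (f : T -> R) (S : set T) :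
  m.-integrable setT (EFin \o f) -> measurable S ->
  (forall w, S w -> 0 < f w)%R -> \int[m]_(w in S) (f w)%:E <= 0 -> m S = 0.
Proof.
move=> intf mS f0 Sf.
have mf : measurable_fun S (EFin \o f).
  exact: measurable_funTS (measurable_int _ intf).
have int0 : \int[m]_(w in S) `|(EFin \o f) w| = 0.
  rewrite (eq_integral (EFin \o f)); last first.
    by move=> w; rewrite inE => /f0 /ltW fw; rewrite gee0_abs.
  apply/le_anti; rewrite Sf integral_ge0// => w Sw.
  by rewrite lee_fin ltW// f0.
have /(ae_eq_integral_abs _ mS mf) [M [mM mM0 fM]] := int0.
apply: (subset_measure0 mS mM) mM0 => w Sw; apply: fM => /= /(_ Sw).
by move=> [fw0]; have := f0 w Sw; rewrite fw0 ltxx.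
Qed.

End MoreIntegrals.

(** * Thresholds from affine inequalities *)

Section Thresholds.
Context {R : realType}.

(** The affine function of the belief p = P(H = 0) with value x.1 at p = 1 and x.2
    at p = 0: the expected cost of an action that costs x.1 if H = 0 and x.2 if
    H = 1. *)
Definition chord (x : R * R) (p : R) : R := p * x.1 + (1 - p) * x.2.

Lemma chord_lipschitz (x : R * R) (K p q e : R) :
  0 <= x.1 <= K -> 0 <= x.2 <= K -> `|p - q| <= e ->
  chord x p <= chord x q + K * e.
Proof.
move=> /andP[x1 x1K] /andP[x2 x2K] pq.
have -> : chord x p = chord x q + (p - q) * (x.1 - x.2) by rewrite /chord; ring.
rewrite lerD2l (le_trans (ler_norm _))// normrM mulrC ler_pM//.
by rewrite ler_norml; apply/andP; split; lra.
Qed.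

(** An affine function that is nonpositive at 0 is nonpositive on an initial
    segment of [0, 1], closed on the right; so is any intersection of such
    segments, and a is its supremum. *)
Lemma chord_threshold (F : set (R * R)) : (forall x, F x -> x.2 <= 0) ->
  exists2 a, 0 <= a <= 1 & forall p, 0 <= p <= 1 ->
    (p <= a <-> forall x, F x -> chord x p <= 0).
Proof.
move=> F0.
pose S := [set p | 0 <= p <= 1 /\ forall x, F x -> chord x p <= 0].
have S0 : S 0.
  split; first by rewrite lexx ler01.
  by move=> x /F0; rewrite /chord mul0r add0r subr0 mul1r.
have ubS : ubound S 1 by move=> p [/andP[]].
have supS : has_sup S by split; [exists 0|exists 1].
exists (sup S).
  rewrite ub_le_sup//=; last by exists 1.
  by rewrite ge_sup//; exists 0.
move=> p p01; split => [pS x Fx|px]; last by apply: ub_le_sup; [exists 1|split].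
rewrite leNgt; apply/negP => xp.
have slope : 0 < x.1 - x.2.
  have := F0 x Fx; move: p01 xp; rewrite /chord.
  case: x {Fx} => a b /= /andP[p0 p1] xp b0.
  rewrite ltNge; apply/negP; rewrite subr_le0 => ab.
  have pba : 0 <= p * (b - a) by rewrite mulr_ge0// subr_ge0.
  lra.
(* The zero of the chord lies before p, and the supremum is at least p, so some
   point of S lies beyond that zero. *)
have zero_lt : - x.2 / (x.1 - x.2) < p.
  by rewrite ltr_pdivrMr//; move: xp; rewrite /chord; lra.
have [q [q01 Sq] qlt] := sup_gt (ex_intro _ 0 S0) (lt_le_trans zero_lt pS).
have := Sq x Fx; move: qlt; rewrite ltr_pdivrMr// /chord; lra.
Qed.

Variable J : bool -> bool -> R.

Definition stop_chord (b : bool) : R * R := (J b false, J b true).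

(** With belief p, deciding b is at least as good as the other decision and as
    every continuation whose pair of costs is in F. *)
Definition stop_optimal (b : bool) (F : set (R * R)) (p : R) : Prop :=
  (forall b', chord (stop_chord b) p <= chord (stop_chord b') p) /\
  (forall x, F x -> chord (stop_chord b) p <= chord x p).

(** The belief at which the two decisions have equal expected costs. *)
Definition terminal_threshold : R :=
  (J false true - J true true) /
  ((J false true - J true true) + (J true false - J false false)).

Hypothesis J01_gt_J11 : J true true < J false true.
Hypothesis J10_gt_J00 : J false false < J true false.

Lemma terminal_threshold_bounds : 0 <= terminal_threshold <= 1.
Proof.
move: J01_gt_J11 J10_gt_J00 => J1 J0.
rewrite /terminal_threshold; apply/andP; split.
  by apply: divr_ge0; lra.
by rewrite ler_pdivrMr; lra.
Qed.

Lemma stop_true_le_false p :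
  (chord (stop_chord true) p <= chord (stop_chord false) p) =
  (p <= terminal_threshold).
Proof.
move: J01_gt_J11 J10_gt_J00 => J1 J0.
rewrite /terminal_threshold ler_pdivlMr; last by lra.
by rewrite /chord /=; apply/idP/idP; lra.
Qed.

Lemma stop_false_le_true p :
  (chord (stop_chord false) p <= chord (stop_chord true) p) =
  (terminal_threshold <= p).
Proof.
move: J01_gt_J11 J10_gt_J00 => J1 J0.
rewrite /terminal_threshold ler_pdivrMr; last by lra.
by rewrite /chord /=; apply/idP/idP; lra.
Qed.

(** The hypothesis says that no continuation beats the correct decision when H is
    known; it makes all the affine inequalities behind [stop_optimal] hold at the
    relevant endpoint. Both decisions are optimal together only at
    [terminal_threshold], which separates the two intervals. *)
Lemma stopping_thresholds (F : set (R * R)) :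
  (forall x, F x -> J false false <= x.1 /\ J true true <= x.2) ->
  exists ab : R * R, [/\ 0 <= ab.1, ab.1 <= ab.2, ab.2 <= 1 &
    forall p, 0 <= p <= 1 ->
      (p <= ab.1 <-> stop_optimal true F p) /\
      (ab.2 <= p <-> stop_optimal false F p)].
Proof.
move=> FJ.
pose diff b := [set (J b false - x.1, J b true - x.2) |
  x in F `|` [set stop_chord (~~ b)]].
have diffP b p : (forall x, diff b x -> chord x p <= 0) <-> stop_optimal b F p.
  split=> [dp|[bp Fp] _ [x [Fx|->] <-]].
  - split=> [b'|x Fx].
      have [->//|bb'] := eqVneq b' b.
      have : diff b (J b false - J b' false, J b true - J b' true).
        by exists (stop_chord b') => //; right; case: b b' bb' {dp} => -[].
      by move=> /dp; rewrite /chord /=; lra.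
    have : diff b (J b false - x.1, J b true - x.2) by exists x => //; left.
    by move=> /dp; rewrite /chord /=; lra.
  - by have := Fp x Fx; rewrite /chord /=; lra.
  - by have := bp (~~ b); rewrite /chord /=; lra.
have [|a a01 aP] := @chord_threshold (diff true).
  by move=> _ [x [/FJ[_ x2]|->] <-] /=; rewrite subr_le0//; exact: ltW.
(* The case of decision 0 is the mirror image under p -> 1 - p. *)
have [|c c01 cP] := @chord_threshold [set (x.2, x.1) | x in diff false].
  by move=> _ [_ [x [/FJ[x1 _]|->] <-] <-] /=; rewrite subr_le0//; exact: ltW.
have aE p : 0 <= p <= 1 -> p <= a <-> stop_optimal true F p.
  by move=> /aP ->; exact: diffP.
have cE p : 0 <= p <= 1 -> 1 - c <= p <-> stop_optimal false F p.
  move=> p01; rewrite -diffP lerBlDr -lerBlDl cP; last by move: p01; lra.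
  have swap x : chord (x.2, x.1) (1 - p) = chord x p by rewrite /chord /=; ring.
  split=> [H x dx|H _ [x dx <-]]; last by rewrite swap; exact: H.
  by rewrite -swap; apply: H; exists x.
exists (a, 1 - c) => /=; split=> //.
- by case/andP: a01.
- have [/(_ (lexx a)) [/(_ false) a1 _] _] := aE a a01.
  have c01' : 0 <= 1 - c <= 1 by move: c01; lra.
  have [/(_ (lexx _)) [/(_ true) c0 _] _] := cE (1 - c) c01'.
  by rewrite (@le_trans _ _ terminal_threshold)//
    -?stop_true_le_false -?stop_false_le_true.
- by move: c01; lra.
- by move=> p p01; split; [exact: aE|exact: cE].
Qed.

Lemma exists_stop_le p : exists b, forall b',
  chord (stop_chord b) p <= chord (stop_chord b') p.
Proof.
have [tf|/ltW ft] := leP (chord (stop_chord true) p) (chord (stop_chord false) p).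
  by exists true; case.
by exists false; case.
Qed.

End Thresholds.

(** * Independence of the observations given the hypothesis *)

Section Model.
Context {R : realType} {d : measure_display} {Omega : measurableType d}
  (P : probability Omega R) (H : {mfun Omega >-> bool})
  {n : nat} {dE : 'I_n.+1 -> measure_display}
  {E : forall i, measurableType (dE i)}
  (Y : forall i, nat -> {mfun Omega >-> E i}).

Lemma measurable_hypothesis h : measurable [set w | H w = h].
Proof.
rewrite (_ : [set w | _] = H @^-1` [set h])//.
by rewrite -[X in measurable X]setTI; exact: measurable_funP.
Qed.

(** The measure A |-> P(A, H = h). It replaces the conditional probability given
    H = h, which is meaningless when P(H = h) = 0. *)
Definition joint_prob (h : bool) := mrestr P (measurable_hypothesis h).

HB.instance Definition _ h :=
  Measure.copy (joint_prob h) (mrestr P (measurable_hypothesis h)).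

Let joint_prob_finite h : fin_num_fun (joint_prob h).
Proof.
move=> A mA; rewrite /joint_prob /mrestr; apply: fin_num_measure.
by apply: measurableI => //; exact: measurable_hypothesis.
Qed.

HB.instance Definition _ h := Measure_isFinite.Build _ _ _ (joint_prob h)
  (joint_prob_finite h).

Definition rectangle (N : nat) (B : forall i, 'I_N -> set (E i)) : set Omega :=
  [set w | forall i s, B i s (Y i s.+1 w)].

(** The rectangles that constrain only the observations (i, s) with I i s; the
    index s stands for time s + 1, up to the horizon N. They form a pi-system that
    generates the sigma-algebra of these observations. *)
Definition rectangles (N : nat) (I : 'I_n.+1 -> nat -> bool) :
    set (set Omega) :=
  [set A | exists B, [/\ forall i s, measurable (B i s),
    forall i (s : 'I_N), ~~ I i s -> B i s = setT & A = @rectangle N B]].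

Lemma measurable_rectangles N I : rectangles N I `<=` measurable.
Proof.
move=> _ [B [mB _ ->]].
rewrite (_ : rectangle B = \bigcap_i \bigcap_s (Y i (val s).+1 @^-1` B i s)); last first.
  by apply/seteqP; split => w Bw i => [_ s _|s]; apply: Bw.
do 2! (apply: fin_bigcap_measurable => [|? _]; first exact: finite_finset).
by rewrite -[X in measurable X]setTI; exact: measurable_funP.
Qed.

Lemma rectangles_setI N I : setI_closed (rectangles N I).
Proof.
move=> _ _ [B1 [mB1 B1T ->]] [B2 [mB2 B2T ->]].
exists (fun i s => B1 i s `&` B2 i s); split => [i s|i s Iis|].
- exact: measurableI.
- by rewrite B1T// B2T// setTI.
- apply/seteqP; split => w; first by move=> [B1w B2w] i s.
  by move=> Bw; split => i s; have [] := Bw i s.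
Qed.

Lemma rectangles_setT N I : rectangles N I setT.
Proof. by exists (fun _ _ => setT); split => //; apply/seteqP; split. Qed.

(** Independence of the sensors and independence in time together make all the
    observations up to time N mutually independent given H = h. *)
Lemma cprob_rectangle N h (B : forall i, 'I_N -> set (E i)) :
  cond_indep_sensors P H Y -> cond_indep_times P H Y ->
  P [set w | H w = h] <> 0%E -> (forall i s, measurable (B i s)) ->
  cprob P H h (rectangle B) =
    \prod_i \prod_(s < N) cprob P H h [set w | B i s (Y i s.+1 w)].
Proof.
move=> indS indT Ph mB.
have rectE i w : (forall s : 'I_N, B i s (tnth (obs Y i N w) s)) <->
    forall s : 'I_N, B i s (Y i s.+1 w).
  by split => Bw s; have := Bw s; rewrite tnth_mktuple.
have := indS h Ph N (fun i => [set y | forall s, B i s (tnth y s)]).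
rewrite /= (_ : [set w | _] = rectangle B); last first.
  by apply/seteqP; split => w Bw i; apply/rectE/Bw.
move=> ->; last first.
  move=> i.
  rewrite (_ : [set y | _] = \bigcap_s ((@tnth N _)^~ s @^-1` B i s)); last first.
    by apply/seteqP; split => y By s => [_|]; apply: By.
  apply: fin_bigcap_measurable => [|s _]; first exact: finite_finset.
  by rewrite -[X in measurable X]setTI; apply: measurable_tnth.
apply: eq_bigr => i _; rewrite -indT//; congr (cprob _ _ _ _).
by apply/seteqP; split => w /rectE.
Qed.

(** Each observation is constrained by at most one of the two rectangles, so the
    product for the intersection splits into the two products factor by factor. *)
Lemma joint_prob_rectangles N I h :
  cond_indep_sensors P H Y -> cond_indep_times P H Y ->
  forall A B, rectangles N I A -> rectangles N (fun i s => ~~ I i s) B ->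
  (joint_prob h (A `&` B) * joint_prob h setT = joint_prob h A * joint_prob h B)%E.
Proof.
move=> indS indT A B rA rB.
have mA := measurable_rectangles rA; have mB := measurable_rectangles rB.
have cprobE C : cprob P H h C = fine (joint_prob h C) / fine (joint_prob h setT).
  by rewrite /cprob /joint_prob /mrestr setTI.
have [Ph0|/eqP Ph] := eqVneq (P [set w | H w = h]) 0%E.
  have u0 C : measurable C -> joint_prob h C = 0%E.
    move=> mC; apply: (subset_measure0 _ _ _ Ph0) => //;
      last exact: measurable_hypothesis.
    by apply: measurableI => //; exact: measurable_hypothesis.
  by rewrite !u0 ?mul0e//; exact: measurableI.
have fineT : fine (joint_prob h setT) != 0.
  apply/eqP => f0; apply: Ph; rewrite -[LHS]fineK ?fin_num_measure//;
    last exact: measurable_hypothesis.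
  by rewrite /joint_prob /mrestr setTI in f0; rewrite f0.
suff : cprob P H h (A `&` B) = cprob P H h A * cprob P H h B.
  rewrite !cprobE => AB.
  rewrite -(fineK (fin_num_measure (joint_prob h) _ (measurableI _ _ mA mB))).
  rewrite -(fineK (fin_num_measure (joint_prob h) _ mA)).
  rewrite -(fineK (fin_num_measure (joint_prob h) _ mB)).
  rewrite -(fineK (fin_num_measure (joint_prob h) _ measurableT)).
  rewrite -!EFinM; congr (_%:E).
  rewrite -[X in X * _ = _](divfK fineT) AB -mulrA mulrACA !divfK//.
case: rA mA => B1 [mB1 B1T ->] mA; case: rB mB => B2 [mB2 B2T ->] mB.
have -> : rectangle B1 `&` rectangle B2 = rectangle (fun i s => B1 i s `&` B2 i s).
  apply/seteqP; split => w; first by move=> [B1w B2w] i s.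
  by move=> Bw; split => i s; have [] := Bw i s.
rewrite !cprob_rectangle//; last by move=> i s; exact: measurableI.
rewrite -big_split; apply: eq_bigr => i _ /=.
rewrite -big_split; apply: eq_bigr => s _ /=.
have cT : cprob P H h setT = 1 by rewrite cprobE divff.
have [Iis|Iis] := boolP (I i s).
  rewrite B2T ?Iis// [X in _ * cprob _ _ _ X](_ : _ = setT) ?cT ?mulr1;
    last by apply/seteqP; split.
  by congr cprob; apply/seteqP; split => w //= [].
rewrite B1T ?Iis// [X in cprob _ _ _ X * _](_ : _ = setT) ?cT ?mul1r;
  last by apply/seteqP; split.
by congr cprob; apply/seteqP; split => w //= [].
Qed.

Lemma measurable_observation N (I : 'I_n.+1 -> nat -> bool) i s : I i s -> (s < N)%N ->
  measurable_fun setT (Y i s.+1 : g_sigma_algebraType (rectangles N I) -> E i).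
Proof.
move=> Iis sN _ B mB; rewrite setTI; apply: sub_sigma_algebra.
exists (fun i' => dfwith (fun i' (_ : 'I_N) => @setT (E i')) i
   (fun s' : 'I_N => if s' == s :> nat then B else setT) i'); split.
- move=> i' s'; have [<-|ne] := eqVneq i i'; last by rewrite dfwithout.
  by rewrite dfwithin; case: ifP.
- move=> i' s' nI; have [ie|ne] := eqVneq i i'; last by rewrite dfwithout.
  by rewrite -ie dfwithin ifF//; apply/negbTE/eqP => se; rewrite -ie se Iis in nI.
- apply/seteqP; split => w /=.
    move=> Bw i' s'; have [ie|ne] := eqVneq i i'; last by rewrite dfwithout.
    by rewrite -ie dfwithin; case: ifP => // /eqP ->.
  by move=> /(_ i (Ordinal sN)); rewrite dfwithin /= eqxx.
Qed.

End Model.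

(** * Observation and message histories *)

(** Replaces the beginning of an observation sequence f by a remembered list y:
    the default value of [nth] takes over where y ends. *)
Definition splice {S : Type} (t : nat) (y : seq S) (f : nat -> S) : t.-tuple S :=
  [tuple nth (f s) y s | s < t].

Lemma measurable_splice {d d' : measure_display} {T : measurableType d}
    {S : measurableType d'} (k t : nat) (y : T -> k.-tuple S) (f : T -> nat -> S) :
  measurable_fun setT y ->
  (forall s, (k <= s < t)%N -> measurable_fun setT (f^~ s)) ->
  measurable_fun setT (fun x => splice t (y x) (f x)).
Proof.
move=> my mf; apply/measurable_fun_tnthP => s.
have [sk|ks] := ltnP s k.
  rewrite (_ : _ \o _ = (@tnth k S)^~ (Ordinal sk) \o y).
    exact: measurableT_comp (measurable_tnth _) my.
  by apply/funext => x /=; rewrite tnth_mktuple (tnth_nth (f x s)).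
rewrite (_ : _ \o _ = f^~ s); first by apply: mf; rewrite ks ltn_ord.
by apply/funext => x /=; rewrite tnth_mktuple nth_default// size_tuple.
Qed.

HB.instance Definition _ (n : nat) :=
  Countable.copy (messages n) {ffun 'I_n -> seq (option bool)}.

(** The messages received by time k, recovered from those received later. *)
Definition restrict_messages {n : nat} (k : nat) (z : messages n) : messages n :=
  [ffun j => take k (z j)].

Section Policies.
Context {n : nat} {dE : 'I_n.+1 -> measure_display}
  {E : forall i, measurableType (dE i)}.

Definition measurable_policy (g : coordinator_policy E) : Prop :=
  forall t z u, (0 < t)%N -> measurable [set y | g t y z = u].

Lemma fiber_measurable_policy {d : measure_display} {T : measurableType d}
    (g : coordinator_policy E) t (y : T -> t.-tuple (E ord0))
    (z : T -> messages n) :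
  measurable_policy g -> (0 < t)%N -> measurable_fun setT y ->
  fiber_measurable z -> fiber_measurable (fun x => g t (y x) (z x)).
Proof.
move=> mg t0 my mz u.
rewrite (_ : [set x | _] = \bigcup_c ([set x | z x = c] `&`
    y @^-1` [set y' | g t y' c = u])).
  apply: countable_bigcupT_measurable => // c; apply: measurableI => //.
  by rewrite -[X in measurable X]setTI; apply: my => //; exact: mg.
by apply/seteqP; split => [x gx|x [c _ [/= ->]]//]; exists (z x).
Qed.

End Policies.

Section Histories.
Context {d : measure_display} {Omega : measurableType d}
  {n : nat} {dE : 'I_n.+1 -> measure_display}
  {E : forall i, measurableType (dE i)}
  (Y : forall i, nat -> {mfun Omega >-> E i})
  (T : 'I_n.+1 -> nat) (Gamma : forall j, peripheral_policy E j)
  (N : nat) (TN : forall i, (T i <= N)%N)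
  (Gamma_adm : peripheral_admissible Y T Gamma).

Lemma splice_obs k t w :
  splice t (obs Y ord0 k w) (fun s => Y ord0 s.+1 w) = obs Y ord0 t w.
Proof.
apply: eq_mktuple => s; have [sk|ks] := ltnP s k.
  by rewrite -[LHS](tnth_nth _ _ (Ordinal sk)) tnth_mktuple.
by rewrite nth_default// size_tuple.
Qed.

Lemma restrict_received k t w : (k <= t)%N ->
  restrict_messages k (received Y T Gamma t w) = received Y T Gamma k w.
Proof.
move=> kt; apply/ffunP => j; rewrite !ffunE -map_take take_iota.
by rewrite minnA (minn_idPl kt).
Qed.

Section SubAlgebra.
Variable I : 'I_n.+1 -> nat -> bool.
Local Notation OmegaI := (g_sigma_algebraType (rectangles Y N I)).

Lemma measurable_id_sub : measurable_fun setT (id : Omega -> OmegaI).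
Proof.
move=> _ A mA; rewrite setTI preimage_id.
suff sub : <<s rectangles Y N I >> `<=` @measurable _ Omega by exact: sub mA.
apply: smallest_sub; first exact: sigma_algebra_measurable.
exact: measurable_rectangles.
Qed.

Lemma measurable_obs_sub i t : (t <= N)%N -> (forall s, (s < t)%N -> I i s) ->
  measurable_fun setT (obs Y i t : OmegaI -> t.-tuple (E i)).
Proof.
move=> tN It; apply/measurable_fun_tnthP => s.
rewrite (_ : _ \o _ = Y i s.+1); last by apply/funext => w; rewrite /= tnth_mktuple.
by apply: measurable_observation; [exact: It|exact: leq_trans tN].
Qed.

Hypothesis Iperipheral : forall j s, I (lift ord0 j) s.

Lemma fiber_measurable_message j t : (0 < t <= N)%N ->
  fiber_measurable (message Y Gamma j t : OmegaI -> option bool).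
Proof.
move=> /andP[t0 tN] u.
rewrite (_ : [set w | _] = obs Y (lift ord0 j) t @^-1` [set y | @Gamma j t y = u])//.
rewrite -[X in measurable X]setTI.
by apply: (@measurable_obs_sub (lift ord0 j) t) => //; exact: Gamma_adm.1.
Qed.

(** The messages of sensor j are determined by its decisions up to the horizon,
    whether or not it has already stopped, and these are finitely many functions
    of its observations. *)
Lemma fiber_measurable_received t :
  fiber_measurable (received Y T Gamma t : OmegaI -> messages n).
Proof.
pose msgs j w := [seq message Y Gamma j s w | s <- iota 1 N].
have mmsgs j : fiber_measurable (msgs j : OmegaI -> _).
  apply: (@fiber_measurable_map _ OmegaI) => s; rewrite mem_iota => /andP[s0 sN].
  by apply: fiber_measurable_message; rewrite s0.
have takeE j m w : (m <= N)%N ->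
    [seq message Y Gamma j s w | s <- iota 1 m] = take m (msgs j w).
  by move=> mN; rewrite -map_take take_iota (minn_idPl mN).
pose stop (j : 'I_n) (l : seq (option bool)) :=
  (find isSome (take (T (lift ord0 j)) l)).+1.
have tauE j w : tau Y T Gamma j w = stop j (msgs j w).
  by rewrite /tau /first_time /stop -takeE// find_map.
have receivedE w j :
    received Y T Gamma t w j = take (minn t (stop j (msgs j w))) (msgs j w).
  rewrite ffunE tauE takeE// geq_min; apply/orP; right.
  by rewrite -tauE; apply: leq_trans (Gamma_adm.2 j w) (TN _).
move=> z; rewrite (_ : [set w | _] = \bigcap_j
    [set w | take (minn t (stop j (msgs j w))) (msgs j w) = z j]).
  apply: (@fin_bigcap_measurable _ OmegaI) => [|j _]; first exact: finite_finset.
  exact: (fiber_measurable_comp (fun l => take (minn t (stop j l)) l) (mmsgs j)).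
apply/seteqP; split => [w /= <- j _|w zw]; first by rewrite /= receivedE.
by apply/ffunP => j; rewrite receivedE; apply: zw.
Qed.

End SubAlgebra.

Lemma fiber_measurable_sub (I : 'I_n.+1 -> nat -> bool) C (f : Omega -> C) :
  fiber_measurable (f : g_sigma_algebraType (rectangles Y N I) -> C) ->
  fiber_measurable f.
Proof.
move=> mf c; have := @measurable_id_sub I measurableT _ (mf c).
by rewrite setTI.
Qed.

Lemma received_measurable t : fiber_measurable (received Y T Gamma t).
Proof.
apply: (@fiber_measurable_sub (fun _ _ => true)).
exact: fiber_measurable_received.
Qed.

Lemma measurable_obs i t : measurable_fun setT (obs Y i t).
Proof.
apply/measurable_fun_tnthP => s.
by rewrite (_ : _ \o _ = Y i s.+1)//; apply/funext => w; rewrite /= tnth_mktuple.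
Qed.

Lemma tau_measurable j : fiber_measurable (tau Y T Gamma j).
Proof.
have TjN := TN (lift ord0 j).
rewrite (_ : tau _ _ _ _ = fun w => (find isSome [seq message Y Gamma j s w |
    s <- iota 1 (T (lift ord0 j))]).+1); last first.
  by apply/funext => w; rewrite /tau /first_time find_map.
apply: (fiber_measurable_comp (fun l => (find isSome l).+1)).
apply: fiber_measurable_map => s; rewrite mem_iota add1n ltnS => /andP[s0 sT].
apply: (@fiber_measurable_sub (fun _ _ => true)).
by apply: fiber_measurable_message => //; rewrite s0 (leq_trans sT).
Qed.

(** Only S0 has a past: all observations of the peripheral sensors count as
    future, so that the messages, including those received by time k, are functions
    of the future. *)
Definition past (k : nat) (i : 'I_n.+1) (s : nat) : bool := (i == ord0) && (s < k)%N.

Definition future k i s := ~~ past k i s.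

(** The decision at time t of a coordinator that uses policy g and remembers y in
    place of its first observations. *)
Definition spliced_decision (g : coordinator_policy E) (y : seq (E ord0)) (t : nat)
    (w : Omega) : option bool :=
  g t (splice t y (fun s => Y ord0 s.+1 w)) (received Y T Gamma t w).

Lemma spliced_decision_obs g k t w :
  spliced_decision g (obs Y ord0 k w) t w = decision Y T Gamma g t w.
Proof. by rewrite /spliced_decision splice_obs. Qed.

Lemma fiber_measurable_spliced_decision (g : coordinator_policy E) k t :
  measurable_policy g -> (0 < t <= N)%N ->
  fiber_measurable (fun x : k.-tuple (E ord0) *
      g_sigma_algebraType (rectangles Y N (future k)) =>
    spliced_decision g x.1 t x.2).
Proof.
move=> mg /andP[t0 tN].
apply: fiber_measurable_policy => //.
  apply: (@measurable_splice _ _ _ _ k t (fun x => x.1)); first exact: measurable_fst.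
  move=> s /andP[ks st].
  have mYs : measurable_fun setT
      (Y ord0 s.+1 : g_sigma_algebraType (rectangles Y N (future k)) -> _).
    apply: measurable_observation; last exact: leq_trans tN.
    by rewrite /future /past negb_and -leqNgt ks orbT.
  exact: measurableT_comp mYs measurable_snd.
move=> z; rewrite (_ : [set x | _] = snd @^-1` [set w | received Y T Gamma t w = z])//.
rewrite -[X in measurable X]setTI; apply: measurable_snd => //.
exact: fiber_measurable_received.
Qed.

End Histories.

(** * Costs of continuing *)

Section RunCost.
Context {R : realType} (c0 L : R) (J : bool -> bool -> R).

(** The cost of a list of successive decisions, None being paid c0. The value at
    the empty list is that of deciding 0; it makes the cost total on policies that
    do not stop in time, at which no admissible policy ever arrives. *)
Definition run_cost (h : bool) (s : seq (option bool)) : R :=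
  foldr (fun u a => if u is Some b then J b h else c0 + a) (J false h) s.

Hypothesis c0_ge0 : 0 <= c0.
Hypothesis J_bounds : forall u h, 0 <= J u h <= L.

Lemma run_cost_ge h a s : a <= J false h -> a <= J true h -> a <= run_cost h s.
Proof.
move=> a0 a1; elim: s => [|[[]|] s IHs] //=.
by rewrite (le_trans IHs)// lerDr.
Qed.

Lemma run_cost_ge0 h s : 0 <= run_cost h s.
Proof.
by apply: run_cost_ge; case/andP: (J_bounds false h); case/andP: (J_bounds true h).
Qed.

Lemma run_cost_le h s : run_cost h s <= c0 *+ size s + L.
Proof.
have JL b : J b h <= L by case/andP: (J_bounds b h).
elim: s => [|[b|] s IHs] /=; first by rewrite mulr0n add0r.
  by rewrite (le_trans (JL b))// lerDr mulrn_wge0.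
by rewrite mulrS -addrA lerD2l.
Qed.

End RunCost.

Section Conditioning.
Context {R : realType} {d : measure_display} {Omega : measurableType d}
  (P : probability Omega R) (H : {mfun Omega >-> bool})
  {n : nat} {dE : 'I_n.+1 -> measure_display}
  {E : forall i, measurableType (dE i)}
  (Y : forall i, nat -> {mfun Omega >-> E i})
  (T : 'I_n.+1 -> nat) (Gamma : forall j, peripheral_policy E j)
  (N : nat) (TN : forall i, (T i <= N)%N)
  (Gamma_adm : peripheral_admissible Y T Gamma)
  (c0 L : R) (J : bool -> bool -> R)
  (indep_sensors : cond_indep_sensors P H Y)
  (indep_times : cond_indep_times P H Y)
  (c0_ge0 : 0 <= c0) (J_bounds : forall u h, 0 <= J u h <= L).

Local Notation Z := (received Y T Gamma).
Local Notation T0 := (T ord0).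
Local Notation OmegaF k := (g_sigma_algebraType (rectangles Y N (future k))).

Lemma ge0_integral_hypotheses (A : set Omega) (f : bool -> Omega -> \bar R) :
  measurable A -> (forall h, measurable_fun setT (f h)) ->
  (forall h w, 0 <= f h w)%E ->
  (\int[P]_(w in A) f (H w) w =
   \int[joint_prob P H false]_(w in A) f false w +
   \int[joint_prob P H true]_(w in A) f true w)%E.
Proof.
move=> mA mf f0.
have mH := measurable_hypothesis H.
have mfH : measurable_fun setT (fun w => f (H w) w).
  by apply: measurable_fun_fibers => //; exact: mH.
have jointE h : (\int[joint_prob P H h]_(w in A) f h w =
    \int[P]_(w in A `&` [set w | H w = h]) f (H w) w)%E.
  rewrite ge0_integral_mrestr//.
  by apply: eq_integral => w; rewrite inE => -[_ /= ->].
rewrite !jointE -ge0_integral_setU//.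
- rewrite -setIUr (_ : _ `|` _ = setT) ?setIT//; apply/seteqP; split => // w _ /=.
    by case: (H w); [right|left].
- exact: measurableI.
- exact: measurableI.
- exact: measurable_funTS.
- by apply/disj_setPS => w [[_ /= ->] [_ ]].
Qed.

Definition cost_from (h : bool) (g : coordinator_policy E) (k : nat) (w : Omega) : R :=
  run_cost c0 J h [seq decision Y T Gamma g t w | t <- iota k (T0.+1 - k)].

Lemma cost_fromS h g k w : (k <= T0)%N ->
  cost_from h g k w = if decision Y T Gamma g k w is Some b then J b h
                      else c0 + cost_from h g k.+1 w.
Proof. by move=> kT; rewrite /cost_from subSn// subSS. Qed.

Lemma cost_from_ge0 h g k w : 0 <= cost_from h g k w.
Proof. exact: run_cost_ge0 J_bounds _ _. Qed.

Lemma measurable_cost_from h g k : measurable_policy g -> (0 < k)%N ->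
  measurable_fun setT (cost_from h g k).
Proof.
move=> mg k0; apply: (measurable_fun_fibers (F := fun s _ => run_cost c0 J h s)) => //.
apply: fiber_measurable_map => t; rewrite mem_iota => /andP[kt _].
apply: fiber_measurable_policy => //; first exact: leq_trans kt.
  exact: measurable_obs.
exact: received_measurable TN Gamma_adm _.
Qed.

(** The cost of continuing at time k with policy g and memory y: one more time
    unit, then the decisions from time k + 1 on. *)
Definition spliced_cost h g k (y : k.-tuple (E ord0)) (w : Omega) : R :=
  c0 + run_cost c0 J h
         [seq spliced_decision Y T Gamma g y t w | t <- iota k.+1 (T0 - k)].

Lemma spliced_cost_obs h g k w :
  spliced_cost h g (obs Y ord0 k w) w = c0 + cost_from h g k.+1 w.
Proof.
rewrite /spliced_cost /cost_from subSS; congr (_ + run_cost _ _ _ _).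
by apply: eq_map => t; rewrite spliced_decision_obs.
Qed.

Lemma spliced_cost_ge h g k (y : k.-tuple (E ord0)) w a :
  a <= J false h -> a <= J true h -> c0 + a <= spliced_cost h g y w.
Proof. by move=> a0 a1; rewrite lerD2l run_cost_ge. Qed.

Lemma spliced_cost_ge0 h g k (y : k.-tuple (E ord0)) w :
  0 <= spliced_cost h g y w.
Proof. by apply: addr_ge0 => //; exact: run_cost_ge0 J_bounds _ _. Qed.

Definition cost_bound : R := c0 *+ T0.+1 + L.

Lemma spliced_cost_le h g k (y : k.-tuple (E ord0)) w :
  spliced_cost h g y w <= cost_bound.
Proof.
rewrite /cost_bound mulrS -addrA lerD2l.
rewrite (le_trans (run_cost_le c0_ge0 J_bounds _ _))// size_map size_iota.
by rewrite lerD2r ler_wpMn2l// leq_subr.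
Qed.

Lemma measurable_spliced_cost h g k : measurable_policy g ->
  measurable_fun setT (fun x : k.-tuple (E ord0) * OmegaF k =>
    (spliced_cost h g x.1 x.2)%:E).
Proof.
move=> mg; apply/measurable_EFinP; apply: measurable_funD => //.
apply: (measurable_fun_fibers (F := fun s _ => run_cost c0 J h s)) => //.
apply: fiber_measurable_map => t; rewrite mem_iota => /andP[kt tT].
apply: fiber_measurable_spliced_decision => //.
rewrite (leq_ltn_trans _ kt)//= (leq_trans _ (TN ord0))//.
move: tT; rewrite addSn ltnS.
have [kT|/ltnW Tk] := leqP k T0; first by rewrite subnKC.
by move: kt; rewrite (eqP Tk) addn0 leqNgt ltnS => /negP.
Qed.

Definition message_event k z := [set w | Z k w = z].

Definition message_mass h k z : R := fine (joint_prob P H h (message_event k z)).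

(** The expectation of [spliced_cost] given H = h and the messages z. When this
    condition has probability 0 the value is arbitrary, and c0 + L is chosen
    because it satisfies the bounds that hold in the other case. *)
Definition conditional_cost h g k z (y : k.-tuple (E ord0)) : R :=
  if message_mass h k z == 0 then c0 + L
  else fine (\int[joint_prob P H h]_(w in message_event k z)
               (spliced_cost h g y w)%:E) / message_mass h k z.

Lemma measurable_message_event k z : measurable (message_event k z).
Proof. exact: received_measurable TN Gamma_adm k z. Qed.

Lemma measurable_message_event_future k k' z :
  measurable (message_event k' z : set (OmegaF k)).
Proof. exact: fiber_measurable_received. Qed.

Definition obs_mfun i t : {mfun Omega >-> t.-tuple (E i)} :=
  HB.pack (obs Y i t) (isMeasurableFun.Build _ _ _ _ _ (@measurable_obs _ _ _ _ _ Y i t)).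

Definition id_mfun k : {mfun Omega >-> OmegaF k} :=
  HB.pack (id : Omega -> OmegaF k)
    (isMeasurableFun.Build _ _ _ _ _ (@measurable_id_sub _ _ _ _ _ Y N (future k))).

(** The first k observations of S0 are independent, given H, of its later
    observations and of all messages. *)
Lemma past_future_independent h k (B : set (k.-tuple (E ord0)))
    (S : set (OmegaF k)) : (k <= N)%N -> measurable B -> measurable S ->
  (joint_prob P H h (obs_mfun ord0 k @^-1` B `&` id_mfun k @^-1` S) *
     joint_prob P H h setT =
   joint_prob P H h (obs_mfun ord0 k @^-1` B) * joint_prob P H h (id_mfun k @^-1` S))%E.
Proof.
move=> kN mB mS.
apply: (@factorization_generated2 _ _ _ (joint_prob P H h) _
    (rectangles Y N (past k)) (rectangles Y N (future k))) => //.
- by rewrite ltey_eq fin_num_measure.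
- exact: measurable_rectangles.
- exact: rectangles_setI.
- exact: rectangles_setT.
- exact: measurable_rectangles.
- exact: rectangles_setI.
- exact: rectangles_setT.
- move=> A C rA rC.
  exact: (@joint_prob_rectangles _ _ _ P H _ _ _ Y N (past k) h indep_sensors
    indep_times A C rA rC).
- have mo : measurable_fun setT
      (obs Y ord0 k : g_sigma_algebraType (rectangles Y N (past k)) -> _).
    by apply: measurable_obs_sub => // s sk; rewrite /past eqxx.
  by have := mo measurableT _ mB; rewrite setTI.
Qed.

Lemma measurable_spliced_cost_section h g k (y : k.-tuple (E ord0)) :
  measurable_policy g ->
  measurable_fun setT (fun w : Omega => (spliced_cost h g y w)%:E).
Proof.
move=> mg.
have my : measurable_fun setT (fun w : Omega => (y, id_mfun k w)).
  exact: measurable_fun_pair.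
exact: measurableT_comp (measurable_spliced_cost h mg) my.
Qed.

Lemma integral_spliced_cost_le h g k (y : k.-tuple (E ord0)) (S : set Omega) :
  measurable_policy g -> measurable S ->
  (\int[joint_prob P H h]_(w in S) (spliced_cost h g y w)%:E
     <= cost_bound%:E * joint_prob P H h S)%E.
Proof.
move=> mg mS; rewrite -integral_cst//; apply: ge0_le_integral => //.
- by move=> w _; rewrite lee_fin spliced_cost_ge0.
- by apply: measurable_funTS; exact: measurable_spliced_cost_section.
- by move=> w _; rewrite lee_fin spliced_cost_le.
Qed.

Lemma message_massE h k z : joint_prob P H h (message_event k z) = (message_mass h k z)%:E.
Proof. by rewrite fineK// fin_num_measure//; exact: measurable_message_event. Qed.

Lemma conditional_cost_message_mass h g k z (y : k.-tuple (E ord0)) :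
  measurable_policy g ->
  ((conditional_cost h g z y * message_mass h k z)%:E =
   \int[joint_prob P H h]_(w in message_event k z) (spliced_cost h g y w)%:E)%E.
Proof.
move=> mg; have mZ := measurable_message_event k z.
have int0 : (0 <= \int[joint_prob P H h]_(w in message_event k z)
    (spliced_cost h g y w)%:E)%E.
  by apply: integral_ge0 => w _; rewrite lee_fin spliced_cost_ge0.
have := integral_spliced_cost_le h y mg mZ; rewrite message_massE => intle.
rewrite /conditional_cost; case: eqVneq intle => [->|m0] intle.
  by rewrite mulr0; apply/le_anti; rewrite int0 (le_trans intle)// mule0.
rewrite divfK// fineK// ge0_fin_numE//.
by rewrite (le_lt_trans intle)// -EFinM ltry.
Qed.

Lemma conditional_cost_ge h g k z (y : k.-tuple (E ord0)) a :
  measurable_policy g ->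
  (forall w, c0 + a <= spliced_cost h g y w) -> 0 <= a -> a <= L ->
  c0 + a <= conditional_cost h g z y.
Proof.
move=> mg ca a0 aL; have mZ := measurable_message_event k z.
have := conditional_cost_message_mass h z y mg.
rewrite /conditional_cost; case: eqVneq => [_ _|m0 E1]; first by rewrite lerD2l.
have m_gt0 : 0 < message_mass h k z by rewrite lt0r m0 fine_ge0.
rewrite -(ler_pM2r m_gt0) -lee_fin E1 EFinM -message_massE -integral_cst//.
apply: ge0_le_integral => //.
- by move=> w _; rewrite lee_fin addr_ge0.
- by apply: measurable_funTS; exact: measurable_spliced_cost_section.
- by move=> w _; rewrite lee_fin.
Qed.

Lemma conditional_cost_ge0 h g k z (y : k.-tuple (E ord0)) :
  measurable_policy g -> 0 <= conditional_cost h g z y.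
Proof.
move=> mg; have J0 u : 0 <= J u h by case/andP: (J_bounds u h).
apply: (@le_trans _ _ (c0 + 0)); first by rewrite addr0.
apply: conditional_cost_ge => // [w|]; first exact: spliced_cost_ge.
by case/andP: (J_bounds true h) => _; apply: le_trans.
Qed.

Lemma conditional_cost_le h g k z (y : k.-tuple (E ord0)) :
  measurable_policy g -> conditional_cost h g z y <= cost_bound.
Proof.
move=> mg; have mZ := measurable_message_event k z.
have := conditional_cost_message_mass h z y mg.
rewrite /conditional_cost; case: eqVneq => [_ _|m0 E1].
  by rewrite /cost_bound lerD2r mulrS lerDl mulrn_wge0.
have m_gt0 : 0 < message_mass h k z by rewrite lt0r m0 fine_ge0.
rewrite -(ler_pM2r m_gt0) -lee_fin E1 EFinM -message_massE.
exact: integral_spliced_cost_le.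
Qed.

Lemma measurable_conditional_cost h g k z : measurable_policy g ->
  measurable_fun setT (conditional_cost h g z : k.-tuple (E ord0) -> R).
Proof.
move=> mg; rewrite /conditional_cost; case: eqVneq => [_|m0]; first exact: measurable_cst.
apply: measurable_funM; last exact: measurable_cst.
apply: measurableT_comp => //.
pose S : set (OmegaF k) := message_event k z.
pose phi := (fun x : k.-tuple (E ord0) * OmegaF k =>
  (spliced_cost h g x.1 x.2)%:E) \_ (setT `*` S).
have mphi : measurable_fun setT phi.
  apply/(measurable_restrictT _ _).1.
    by apply: measurableX => //; exact: measurable_message_event_future.
  by apply: measurable_funTS; exact: measurable_spliced_cost.
have phi0 x : (0 <= phi x)%E.
  by apply: erestrict_ge0 => ? _; rewrite lee_fin spliced_cost_ge0.
have := measurable_integral_section (joint_prob P H h) (id_mfun k) mphi phi0.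
congr (measurable_fun _ _); apply/funext => y.
rewrite [RHS]integral_mkcond; apply: eq_integral => w _.
rewrite /phi !patchE; congr (if _ then _ else _).
by apply/idP/idP; rewrite !inE; [case|split].
Qed.

(** Once the messages are fixed, averaging over the future replaces the actual
    cost of continuing by the conditional one, whatever event B of the past is
    imposed, because the past enters only as the memory. *)
Lemma integral_spliced_cost h g k z (B : set (k.-tuple (E ord0))) :
  (k <= N)%N -> measurable_policy g -> measurable B ->
  (\int[joint_prob P H h]_(w in obs Y ord0 k @^-1` B `&` message_event k z)
     (spliced_cost h g (obs Y ord0 k w) w)%:E =
   \int[joint_prob P H h]_(w in obs Y ord0 k @^-1` B `&` message_event k z)
     (conditional_cost h g z (obs Y ord0 k w))%:E)%E.
Proof.
move=> kN mg mB.
pose phi (x : k.-tuple (E ord0) * OmegaF k) := (spliced_cost h g x.1 x.2)%:E.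
pose psi (x : k.-tuple (E ord0) * OmegaF k) := (conditional_cost h g z x.1)%:E.
have cc0 (y : k.-tuple (E ord0)) : 0 <= conditional_cost h g z y.
  exact: conditional_cost_ge0.
apply: (@integral_decoupling_eq _ _ _ _ _ _ _ (joint_prob P H h)
  (obs_mfun ord0 k) (id_mfun k) B (message_event k z) phi psi) => //.
- by move=> A C mA mC; exact: past_future_independent.
- exact: measurable_message_event_future.
- exact: measurable_spliced_cost.
- by move=> x; rewrite lee_fin spliced_cost_ge0.
- apply/measurable_EFinP; apply: measurableT_comp measurable_fst.
  exact: measurable_conditional_cost.
- by move=> x; rewrite lee_fin.
- move=> y; rewrite -[LHS](conditional_cost_message_mass h z y mg) EFinM -message_massE.
  rewrite -integral_cst//; exact: measurable_message_event.
Qed.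


(** The events known to S0 at time k. *)
Definition history_set k (B : messages n -> set (k.-tuple (E ord0))) : set Omega :=
  [set w | B (Z k w) (obs Y ord0 k w)].

Lemma measurable_history_set k (B : messages n -> set (k.-tuple (E ord0))) :
  (forall z, measurable (B z)) -> measurable (history_set B).
Proof.
move=> mB; rewrite (_ : history_set B =
    \bigcup_z (message_event k z `&` obs Y ord0 k @^-1` B z)).
  apply: countable_bigcupT_measurable => // z; apply: measurableI.
    exact: measurable_message_event.
  by rewrite -[X in measurable X]setTI; exact: measurable_obs.
by apply/seteqP; split => [w Bw|w [z _ [/= <-]]//]; exists (Z k w).
Qed.

Lemma measurable_history_fun k (f : messages n -> k.-tuple (E ord0) -> R) :
  (forall z, measurable_fun setT (f z)) ->
  measurable_fun setT (fun w => f (Z k w) (obs Y ord0 k w)).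
Proof.
move=> mf.
apply: (measurable_fun_fibers (F := fun z w => f z (obs Y ord0 k w))).
  exact: received_measurable TN Gamma_adm k.
by move=> z; apply: measurableT_comp (mf z) _; exact: measurable_obs.
Qed.

(** * The belief as a conditional weight *)

Section Belief.
Variables (pi : belief_map E R) (pi_belief : is_belief P H Y T Gamma pi).

Definition belief_at k w : R := @pi k (obs Y ord0 k w) (Z k w).

Lemma belief_lt0_null k : (0 < k)%N -> P [set w | belief_at k w < 0] = 0%E.
Proof.
move=> k0; have [mpi ipi piE] := pi_belief k0.
have mB z : measurable [set y | @pi k y z < 0].
  rewrite (_ : [set y | _] = (fun y => @pi k y z) @^-1` `]-oo, 0[); last first.
    by apply/seteqP; split => y; rewrite /= in_itv.
  by rewrite -[X in measurable X]setTI; exact: mpi.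
have mS := measurable_history_set mB; have := piE _ mB => {}piE.
apply: (@null_of_integral_le0 _ _ _ P (fun w => - 1 * belief_at k w)).
- exact: eq_integrable (integrableZl measurableT (-1) ipi).
- exact: mS.
- by move=> w /=; rewrite mulN1r oppr_gt0.
- under eq_integral do rewrite EFinM.
  rewrite integralZl//; last exact: integrableS ipi.
  by rewrite [X in (_ * X)%E]piE EFinN mulN1e oppe_le0.
Qed.

Lemma belief_gt1_null k : (0 < k)%N -> P [set w | 1 < belief_at k w] = 0%E.
Proof.
move=> k0; have [mpi ipi piE] := pi_belief k0.
have mB z : measurable [set y | 1 < @pi k y z].
  rewrite (_ : [set y | _] = (fun y => @pi k y z) @^-1` `]1, +oo[); last first.
    by apply/seteqP; split => y; rewrite /= in_itv /= andbT.
  by rewrite -[X in measurable X]setTI; exact: mpi.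
have mS := measurable_history_set mB; have := piE _ mB => {}piE.
have i1 : P.-integrable setT (fun=> 1%E : \bar R).
  exact: (finite_measure_integrable_cst P 1).
apply: (@null_of_integral_le0 _ _ _ P (fun w => belief_at k w - 1)).
- exact: eq_integrable (integrableB measurableT ipi i1).
- exact: mS.
- by move=> w /=; rewrite subr_gt0.
- under eq_integral do rewrite EFinB.
  rewrite integralB//; [|exact: integrableS ipi|exact: integrableS i1].
  rewrite [X in (X - _)%E]piE integral_cst// mul1e.
  rewrite sube_le0; apply: le_measure; rewrite ?inE//; last by move=> w [].
  rewrite (_ : [set w | _] = [set w | H w = false] `&`
    history_set (fun z => [set y | 1 < @pi k y z]))//.
  by apply: measurableI => //; exact: measurable_hypothesis.
Qed.

(** A version of the belief may leave [0, 1] on a null event only: its integral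
    over the event where it is negative is a probability, and its integral over
    the event where it exceeds 1 is at most the probability of that event. *)
Lemma belief_range k : (0 < k)%N ->
  {ae P, forall w, 0 <= belief_at k w <= 1}.
Proof.
move=> k0; have [mpi _ _] := pi_belief k0.
have mb : measurable_fun setT (belief_at k).
  exact: (measurable_history_fun (f := fun z y => @pi k y z)).
have m0 : measurable [set w | belief_at k w < 0].
    rewrite (_ : [set w | _] = belief_at k @^-1` `]-oo, 0[); last first.
      by apply/seteqP; split => y; rewrite /= in_itv.
    by rewrite -[X in measurable X]setTI; exact: mb.
have m1 : measurable [set w | 1 < belief_at k w].
  rewrite (_ : [set w | _] = belief_at k @^-1` `]1, +oo[); last first.
    by apply/seteqP; split => y; rewrite /= in_itv /= andbT.
  by rewrite -[X in measurable X]setTI; exact: mb.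
exists ([set w | belief_at k w < 0] `|` [set w | 1 < belief_at k w]); split.
- exact: measurableU.
- by rewrite measureU0//; [exact: belief_lt0_null|exact: belief_gt1_null].
- move=> w /= /negP; rewrite negb_and -!ltNge => /orP[]; by [left|right].
Qed.

(** The conditional probability of H = h, truncated so as to lie in [0, 1]
    everywhere. *)
Definition posterior h k z (y : k.-tuple (E ord0)) : R :=
  let p := Num.max 0 (Num.min (@pi k y z) 1) in if h then 1 - p else p.

Lemma posterior_bounds h k z (y : k.-tuple (E ord0)) : 0 <= posterior h z y <= 1.
Proof.
have p01 : 0 <= Num.max 0 (Num.min (@pi k y z) 1) <= 1.
  by rewrite le_max lexx /= ge_max ler01 ge_min lexx orbT.
by case: h; rewrite /posterior ?subr_ge0 ?lerBlDl ?lerDr //= andbC.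
Qed.

Lemma posteriorE h k z (y : k.-tuple (E ord0)) : 0 <= @pi k y z <= 1 ->
  posterior h z y = if h then 1 - @pi k y z else @pi k y z.
Proof.
move=> /andP[p0 p1]; rewrite /posterior.
by rewrite (min_idPl p1) (max_idPr p0).
Qed.

Lemma measurable_posterior h k z : (0 < k)%N ->
  measurable_fun setT (posterior h z : k.-tuple (E ord0) -> R).
Proof.
move=> k0; have [mpi _ _] := pi_belief k0.
have mp : measurable_fun setT (fun y => Num.max 0 (Num.min (@pi k y z) 1)).
  by apply: measurable_maxr => //; apply: measurable_minr.
by case: h; rewrite /posterior//; apply: measurable_funB.
Qed.

Lemma joint_prob_history_set h k (B : messages n -> set (k.-tuple (E ord0))) :
  (0 < k)%N ->
  (forall z, measurable (B z)) ->
  (joint_prob P H h (history_set B) =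
   \int[P]_(w in history_set B) (posterior h (Z k w) (obs Y ord0 k w))%:E)%E.
Proof.
move=> k0 mB; have [mpi ipi piE] := pi_belief k0.
have mS := measurable_history_set mB.
have mpost h' : measurable_fun setT
    (fun w => (posterior h' (Z k w) (obs Y ord0 k w))%:E).
  apply/measurable_EFinP; apply: (measurable_history_fun (f := posterior h' (k := k))).
  by move=> z; exact: measurable_posterior.
have joint_false : (joint_prob P H false (history_set B) =
    \int[P]_(w in history_set B) (posterior false (Z k w) (obs Y ord0 k w))%:E)%E.
  rewrite (_ : joint_prob P H false (history_set B) =
    P [set w | H w = false /\ B (Z k w) (obs Y ord0 k w)]); last first.
    by rewrite /joint_prob /mrestr setIC.
  rewrite -piE//; apply: ae_eq_integral => //.
  - exact: measurable_funTS (measurable_int _ ipi).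
  - exact: measurable_funTS.
  - apply: filterS (belief_range k0) => w w01 _.
    by rewrite posteriorE.
case: h => //.
have post_sum :
    (\int[P]_(w in history_set B) (posterior false (Z k w) (obs Y ord0 k w))%:E +
     \int[P]_(w in history_set B) (posterior true (Z k w) (obs Y ord0 k w))%:E =
     P (history_set B))%E.
  rewrite -ge0_integralD//.
  - under eq_integral do rewrite -EFinD /posterior subrKC.
    by rewrite integral_cst// mul1e.
  - by move=> w _; rewrite lee_fin;
      case/andP: (posterior_bounds false (Z k w) (obs Y ord0 k w)).
  - exact: measurable_funTS.
  - by move=> w _; rewrite lee_fin;
      case/andP: (posterior_bounds true (Z k w) (obs Y ord0 k w)).
  - exact: measurable_funTS.
have joint_sum : (joint_prob P H false (history_set B) +
    joint_prob P H true (history_set B) = P (history_set B))%E.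
  rewrite /joint_prob /mrestr -measureU//.
  - rewrite -setIUr (_ : _ `|` _ = setT) ?setIT//; apply/seteqP; split => // w _ /=.
    by case: (H w); [right|left].
  - by apply: measurableI => //; exact: measurable_hypothesis.
  - by apply: measurableI => //; exact: measurable_hypothesis.
  - by apply/seteqP; split => // w [[_ /= ->] []].
have ffin : joint_prob P H false (history_set B) \is a fin_num by exact: fin_num_measure.
apply: (addeI ffin); rewrite joint_sum -post_sum; congr (_ + _)%E.
exact/esym.
Qed.

(** The posterior is the density of P(., H = h) with respect to P for events known
    at time k. *)
Lemma integral_joint_prob h k z (B : set (k.-tuple (E ord0)))
    (f : k.-tuple (E ord0) -> R) :
  (0 < k)%N -> measurable B -> measurable_fun setT f -> (forall y, 0 <= f y) ->
  (\int[joint_prob P H h]_(w in obs Y ord0 k @^-1` B `&` message_event k z)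
     (f (obs Y ord0 k w))%:E =
   \int[P]_(w in obs Y ord0 k @^-1` B `&` message_event k z)
     (posterior h z (obs Y ord0 k w) * f (obs Y ord0 k w))%:E)%E.
Proof.
move=> k0 mB mf f0; have mZ := measurable_message_event k z.
have mobs A : measurable A -> measurable (obs Y ord0 k @^-1` A).
  by move=> mA; rewrite -[X in measurable X]setTI; exact: measurable_obs.
have post0 (y : k.-tuple (E ord0)) : 0 <= posterior h z y.
  by case/andP: (posterior_bounds h z y).
have mpost := measurable_posterior h z k0.
have mfo : measurable_fun setT (fun w => (f (obs Y ord0 k w))%:E).
  by apply/measurable_EFinP; apply: measurableT_comp => //; exact: measurable_obs.
have mpo : measurable_fun setT (fun w => (posterior h z (obs Y ord0 k w))%:E).
  by apply/measurable_EFinP; apply: measurableT_comp => //; exact: measurable_obs.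
rewrite -(ge0_integral_mrestr (joint_prob P H h) mZ (mobs _ mB))//; last first.
  by move=> w; rewrite lee_fin.
rewrite -(ge0_integral_mrestr P mZ (mobs _ mB))//; last 2 first.
- by apply/measurable_EFinP; apply: measurable_funM; exact/measurable_EFinP.
- by move=> w; rewrite lee_fin mulr_ge0.
under [RHS]eq_integral do rewrite mulrC EFinM.
apply: (@ge0_integral_density_comp _ _ _ _ _ (mrestr (joint_prob P H h) mZ)
  (mrestr P mZ) (obs_mfun ord0 k) (posterior h z) (EFin \o f) B) => //.
- exact/measurable_EFinP.
move=> A mA _; rewrite ge0_integral_mrestr//; last 2 first.
- exact: mobs.
- by move=> w; rewrite lee_fin.
pose B' z' := if z' == z then A else set0.
have BE : obs_mfun ord0 k @^-1` A `&` message_event k z = history_set B'.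
  apply/seteqP; split => w; rewrite /history_set /message_event /B' /=.
    by move=> [Aw ->]; rewrite eqxx.
  by case: eqP => // ->.
rewrite BE -[LHS]/(joint_prob P H h (_ `&` _)) BE joint_prob_history_set//; last first.
  by move=> z'; rewrite /B'; case: ifP.
apply: eq_integral => w; rewrite inE /history_set /B' /=.
by case: eqP => // ->.
Qed.

(** The expected cost from time k on given H = h, z and y, of a policy g that acts
    at time k according to y and remembers y afterwards. *)
Definition stage_cost h g k z (y : k.-tuple (E ord0)) : R :=
  if g k y z is Some b then J b h else conditional_cost h g z y.

Lemma stage_cost_ge0 h g k z (y : k.-tuple (E ord0)) : measurable_policy g ->
  0 <= stage_cost h g z y.
Proof.
move=> mg; rewrite /stage_cost; case: (g k y z) => [b|].
  by case/andP: (J_bounds b h).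
exact: conditional_cost_ge0.
Qed.

Lemma measurable_stage_cost h g k z : (0 < k)%N -> measurable_policy g ->
  measurable_fun setT (stage_cost h g z : k.-tuple (E ord0) -> R).
Proof.
move=> k0 mg.
apply: (measurable_fun_fibers (f := fun y : k.-tuple (E ord0) => g k y z)
  (F := fun u (y : k.-tuple (E ord0)) =>
    if u is Some b then J b h else conditional_cost h g z y)).
  by move=> u; exact: mg.
by case=> [b|]; [exact: measurable_cst|exact: measurable_conditional_cost].
Qed.

Definition weighted_cost h g k w : R :=
  posterior h (Z k w) (obs Y ord0 k w) * stage_cost h g (Z k w) (obs Y ord0 k w).

Lemma weighted_cost_ge0 h g k w : measurable_policy g -> 0 <= weighted_cost h g k w.
Proof.
move=> mg; apply: mulr_ge0; last exact: stage_cost_ge0.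
by case/andP: (posterior_bounds h (Z k w) (obs Y ord0 k w)).
Qed.

Lemma measurable_weighted_cost h g k : (0 < k)%N -> measurable_policy g ->
  measurable_fun setT (weighted_cost h g k).
Proof.
move=> k0 mg; apply: (measurable_history_fun (k := k)
  (f := fun z y => posterior h z y * stage_cost h g z y)) => z.
apply: measurable_funM; first exact: measurable_posterior.
exact: measurable_stage_cost.
Qed.

(** The event is cut into the countably many pieces on which the messages and the
    decision at time k are constant. *)
Lemma integral_joint_cost_from h g k (B : messages n -> set (k.-tuple (E ord0))) :
  (0 < k <= T0)%N -> measurable_policy g -> (forall z, measurable (B z)) ->
  (\int[joint_prob P H h]_(w in history_set B) (cost_from h g k w)%:E =
   \int[P]_(w in history_set B) (weighted_cost h g k w)%:E)%E.
Proof.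
move=> /andP[k0 kT] mg mB; have kN := leq_trans kT (TN ord0).
apply: (ge0_integral_fibers (Z := fun w => (Z k w, decision Y T Gamma g k w))).
- move=> [z u]; rewrite (_ : [set w | _] = [set w | Z k w = z] `&`
      [set w | decision Y T Gamma g k w = u]).
    apply: measurableI; first exact: received_measurable TN Gamma_adm k z.
    apply: fiber_measurable_policy => //; first exact: measurable_obs.
    exact: received_measurable TN Gamma_adm k.
  by apply/seteqP; split => w /= [-> ->].
- exact: measurable_history_set.
- by apply/measurable_EFinP; exact: measurable_cost_from.
- by apply/measurable_EFinP; exact: measurable_weighted_cost.
- by move=> w; rewrite lee_fin cost_from_ge0.
- by move=> w; rewrite lee_fin weighted_cost_ge0.
move=> [z u].
pose B' : set (k.-tuple (E ord0)) := B z `&` [set y | g k y z = u].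
have mB' : measurable B' by apply: measurableI => //; exact: mg.
have BE : history_set B `&` [set w | (Z k w, decision Y T Gamma g k w) = (z, u)] =
    obs Y ord0 k @^-1` B' `&` message_event k z.
  apply/seteqP; split => w.
    by move=> [Bw [zw uw]]; split => //; split; rewrite /= -zw.
  move=> [[Bw uw] zw]; split; first by rewrite /history_set /= zw.
  by rewrite /= /decision zw uw.
rewrite BE.
transitivity (\int[joint_prob P H h]_(w in obs Y ord0 k @^-1` B' `&` message_event k z)
    (stage_cost h g z (obs Y ord0 k w))%:E)%E.
  have decE w : (obs Y ord0 k @^-1` B' `&` message_event k z) w ->
      decision Y T Gamma g k w = u /\ g k (obs Y ord0 k w) z = u.
    by move=> [[_ uw] zw]; rewrite /decision zw.
  case: u @B' mB' BE decE => [b|] B' mB' BE decE.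
    apply: eq_integral => w; rewrite inE => /decE[dw gw].
    by rewrite cost_fromS// dw /stage_cost gw.
  transitivity (\int[joint_prob P H h]_(w in obs Y ord0 k @^-1` B' `&` message_event k z)
      (spliced_cost h g (obs Y ord0 k w) w)%:E)%E.
    apply: eq_integral => w; rewrite inE => /decE[dw gw].
    by rewrite cost_fromS// dw spliced_cost_obs.
  rewrite integral_spliced_cost//; apply: eq_integral => w.
  by rewrite inE => /decE[dw gw]; rewrite /stage_cost gw.
rewrite integral_joint_prob//; last 2 first.
- exact: measurable_stage_cost.
- by move=> y; exact: stage_cost_ge0.
by apply: eq_integral => w; rewrite inE => -[_ zw]; rewrite /weighted_cost zw.
Qed.

Definition expected_stage_cost g k w : R :=
  weighted_cost false g k w + weighted_cost true g k w.

(** Summing over the two hypotheses leaves an integrand that depends on what S0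
    knows at time k only, so that policies can be compared pointwise. *)
Lemma integral_cost_from g k (B : messages n -> set (k.-tuple (E ord0))) :
  (0 < k <= T0)%N -> measurable_policy g -> (forall z, measurable (B z)) ->
  (\int[P]_(w in history_set B) (cost_from (H w) g k w)%:E =
   \int[P]_(w in history_set B) (expected_stage_cost g k w)%:E)%E.
Proof.
move=> kT mg mB; have /andP[k0 _] := kT.
have mE := measurable_history_set mB.
rewrite (ge0_integral_hypotheses (f := fun h w => (cost_from h g k w)%:E))//.
- rewrite !integral_joint_cost_from// -ge0_integralD//.
  + by move=> w _; rewrite lee_fin weighted_cost_ge0.
  + by apply: measurable_funTS; apply/measurable_EFinP; exact: measurable_weighted_cost.
  + by move=> w _; rewrite lee_fin weighted_cost_ge0.
  + by apply: measurable_funTS; apply/measurable_EFinP; exact: measurable_weighted_cost.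
- by move=> h; apply/measurable_EFinP; exact: measurable_cost_from.
- by move=> h w; rewrite lee_fin cost_from_ge0.
Qed.

(** * Nearly optimal continuations *)

Definition cost_pair g k z (y : k.-tuple (E ord0)) : R * R :=
  (conditional_cost false g z y, conditional_cost true g z y).

Definition cost_pairs k z : set (R * R) :=
  [set x | exists g (y : k.-tuple (E ord0)),
     measurable_policy g /\ x = cost_pair g z y].

Lemma cost_pairs_bounds k z x : cost_pairs k z x ->
  (0 <= x.1 <= cost_bound) /\ (0 <= x.2 <= cost_bound).
Proof.
by move=> [g [y [mg ->]]]; rewrite /= !conditional_cost_ge0 ?conditional_cost_le.
Qed.

Lemma cost_pairs_ge k z x :
  J true true <= J false true -> J false false <= J true false ->
  cost_pairs k z x -> J false false <= x.1 /\ J true true <= x.2.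
Proof.
move=> J1 J0 [g [y [mg ->]]] /=.
have Jb u h : 0 <= J u h /\ J u h <= L by apply/andP; exact: J_bounds.
split.
- apply: (@le_trans _ _ (c0 + J false false)); first by rewrite lerDr.
  apply: conditional_cost_ge => //; [|exact: (Jb _ _).1|exact: (Jb _ _).2].
  by move=> w; exact: spliced_cost_ge.
- apply: (@le_trans _ _ (c0 + J true true)); first by rewrite lerDr.
  apply: conditional_cost_ge => //; [|exact: (Jb _ _).1|exact: (Jb _ _).2].
  by move=> w; exact: spliced_cost_ge.
Qed.

(** At the horizon a continuation is a decision for 0 that is paid one time unit
    late. *)
Lemma cost_pairs_terminal z x p : 0 <= p <= 1 -> cost_pairs T0 z x ->
  chord (stop_chord J false) p <= chord x p.
Proof.
move=> /andP[p0 p1] [g [y [mg ->]]].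
have cc h : J false h <= conditional_cost h g z y.
  have /andP[J0 JL] := J_bounds false h.
  apply: (@le_trans _ _ (c0 + J false h)); first by rewrite lerDr.
  by apply: conditional_cost_ge => // w; rewrite /spliced_cost subnn.
by rewrite /chord /=; apply: lerD; apply: ler_wpM2l; rewrite ?subr_ge0.
Qed.

(** The infimum over continuations exists because the costs are nonnegative, and
    it is approached up to e. *)
Lemma near_optimal_pair k z p e : 0 <= p <= 1 -> 0 < e ->
  exists gy : coordinator_policy E * k.-tuple (E ord0),
    measurable_policy gy.1 /\
    forall x, cost_pairs k z x -> chord (cost_pair gy.1 z gy.2) p <= chord x p + e.
Proof.
move=> /andP[p0 p1] e0.
pose S := [set chord x p | x in cost_pairs k z].
have S0 : S !=set0.
  pose g : coordinator_policy E := fun _ _ _ => None.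
  exists (chord (cost_pair g z [tuple point | _ < k]) p).
  exists (cost_pair g z [tuple point | _ < k]) => //.
  exists g, [tuple point | _ < k]; split => // t z' u _.
  exact: fiber_measurable_cst.
have lbS : lbound S 0.
  move=> _ [x /cost_pairs_bounds[/andP[x1 _] /andP[x2 _]] <-].
  by rewrite /chord addr_ge0// mulr_ge0// subr_ge0.
have [_ [_ [g [y [mg ->]]] <-] lt_inf] := inf_adherent e0 (conj S0 (ex_intro _ 0 lbS)).
exists (g, y); split => //= x Sx; apply: (le_trans (ltW lt_inf)).
by rewrite lerD2r ge_inf//; [exists 0|exists x].
Qed.

Definition prefix k (s : seq (E ord0)) : k.-tuple (E ord0) :=
  splice k s (fun=> point).

Lemma prefix_splice k t (y : k.-tuple (E ord0)) f : (k <= t)%N ->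
  prefix k (splice t y f) = y.
Proof.
move=> kt; apply: eq_from_tnth => s; rewrite tnth_mktuple.
have st := leq_trans (ltn_ord s) kt.
by rewrite -(tnth_nth _ _ (Ordinal st)) tnth_mktuple/= (tnth_nth (f s)).
Qed.

(** From time k + 1 on, use the policy and the memory that the selector sel picks
    from the observations and messages of time k. *)
Definition switch_by (k : nat)
    (sel : k.-tuple (E ord0) -> messages n -> coordinator_policy E * k.-tuple (E ord0)) :
    coordinator_policy E :=
  fun t y z =>
    if (t <= k)%N then None
    else (sel (prefix k y) (restrict_messages k z)).1 t
           (splice t (sel (prefix k y) (restrict_messages k z)).2 (nth point y)) z.

Lemma spliced_decision_switch k sel (y : k.-tuple (E ord0)) t w : (k < t)%N ->
  spliced_decision Y T Gamma (@switch_by k sel) y t w =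
  spliced_decision Y T Gamma (sel y (Z k w)).1 (sel y (Z k w)).2 t w.
Proof.
move=> kt; rewrite /spliced_decision /switch_by ifF; last by rewrite leqNgt kt.
rewrite prefix_splice ?(ltnW kt)//.
rewrite restrict_received ?(ltnW kt)//.
set y' := (sel y (Z k w)).2; set s := splice t _ _; set s' := splice t _ _.
suff -> : s = s' by [].
apply: eq_mktuple => i; have [ik|ki] := ltnP i k.
  by apply: set_nth_default; rewrite size_tuple.
rewrite !(nth_default _ (_ : size y' <= i)%N) ?size_tuple//.
by rewrite -tnth_nth tnth_mktuple nth_default ?size_tuple.
Qed.

(** On the event that the messages are z, remembering y makes the selector pick
    sel y z, and the remembered list is then replaced by the picked one. *)
Lemma conditional_cost_switch h k sel z (y : k.-tuple (E ord0)) :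
  conditional_cost h (@switch_by k sel) z y =
  conditional_cost h (sel y z).1 z (sel y z).2.
Proof.
rewrite /conditional_cost; case: ifP => // _; congr (fine _ / _).
apply: eq_integral => w; rewrite inE => zw; congr (_%:E).
congr (_ + run_cost _ _ _ _); apply/eq_in_map => t.
by rewrite mem_iota => /andP[kt _]; rewrite spliced_decision_switch// zw.
Qed.

Lemma measurable_prefix k t :
  measurable_fun setT (fun y : t.-tuple (E ord0) => prefix k y).
Proof. by apply: (@measurable_splice _ _ _ _ t k id (fun _ _ => point)). Qed.

(** The selection goes through a map with countably many values, so the policy is
    pasted from countably many measurable ones. *)
Lemma measurable_switch k sel (i : messages n -> k.-tuple (E ord0) -> nat)
    (tab : messages n -> nat -> coordinator_policy E * k.-tuple (E ord0)) :
  (forall z, fiber_measurable (i z)) ->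
  (forall z j, measurable_policy (tab z j).1) ->
  (forall y z, sel y z = tab z (i z y)) ->
  measurable_policy (@switch_by k sel).
Proof.
move=> mi mtab selE t z u t0; rewrite /switch_by.
have [tk|kt] := leqP t k; first exact: fiber_measurable_cst.
set zk := restrict_messages k z.
rewrite (_ : [set y | _] = \bigcup_j
   ((fun y : t.-tuple (E ord0) => prefix k y) @^-1` [set y | i zk y = j] `&`
    (fun y : t.-tuple (E ord0) => splice t (tab zk j).2 (nth point y)) @^-1`
      [set y | (tab zk j).1 t y z = u])); last first.
  apply/seteqP; split => y /=; rewrite selE.
    by move=> <-; exists (i zk (prefix k y)).
  by move=> [j _ [/= ->]].
apply: countable_bigcupT_measurable => // j; apply: measurableI.
  by rewrite -[X in measurable X]setTI; apply: measurable_prefix => //; exact: mi.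
rewrite -[X in measurable X]setTI.
apply: (@measurable_splice _ _ _ _ k t (fun=> (tab zk j).2)
   (fun y : t.-tuple (E ord0) => nth point y)) => //.
  move=> s /andP[_ st].
  rewrite (_ : (fun y : t.-tuple (E ord0) => _) = (@tnth t _)^~ (Ordinal st)); last first.
    by apply/funext => y; rewrite (tnth_nth point).
  exact: measurable_tnth.
exact: mtab.
Qed.

(** The chords of [cost_pairs] are Lipschitz with a common constant, so one nearly
    optimal continuation for each grid point serves all the beliefs next to it. *)
Lemma near_optimal_policy k e : (0 < k)%N -> 0 < e ->
  exists2 g, measurable_policy g & forall z (y : k.-tuple (E ord0)),
    0 <= @pi k y z <= 1 -> forall x, cost_pairs k z x ->
    chord (cost_pair g z y) (@pi k y z) <= chord x (@pi k y z) + e.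
Proof.
move=> k0 e0; have [mpi _ _] := pi_belief k0.
(* The mesh 1 / M is such that moving p to the grid changes any cost by at most
   e / 3; this is done twice, and the choice at the grid point costs e / 3. *)
pose M : R := (Num.truncn (3 * cost_bound / e)).+1%:R.
have M0 : 0 < M by rewrite ltr0n.
have KM : cost_bound * M^-1 <= e / 3.
  have : 3 * cost_bound / e < M by exact: truncnS_gt.
  rewrite ler_pdivrMr// ltr_pdivrMr//; lra.
have e3 : 0 < e / 3 by rewrite divr_gt0.
(* The cap at 1 keeps the grid points j / M with j > M among the beliefs. *)
pose grid (j : nat) : R := Num.min (j%:R / M) 1.
have grid01 j : 0 <= grid j <= 1.
  by rewrite le_min ler01 divr_ge0 ?(ltW M0)//= ge_min lexx orbT.
have /choice[tab tabP] (zj : messages n * nat) :=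
  near_optimal_pair k zj.1 (grid01 zj.2) e3.
pose sel (y : k.-tuple (E ord0)) z := tab (z, Num.truncn (M * @pi k y z)).
exists (switch_by sel) => [|z y p01 x Sx].
  apply: (measurable_switch (i := fun z y => Num.truncn (M * @pi k y z))
    (tab := fun z j => tab (z, j))) => // [z|z j].
    by apply: fiber_measurable_truncn; apply: measurable_funM => //; exact: mpi.
  exact: (tabP (z, j)).1.
have -> : cost_pair (switch_by sel) z y = cost_pair (sel y z).1 z (sel y z).2.
  by rewrite /cost_pair !conditional_cost_switch.
set p := @pi k y z in p01 *; set j := Num.truncn (M * p).
have [mg gP] := tabP (z, j); rewrite /= in mg gP.
have -> : sel y z = tab (z, j) by [].
have /andP[p0 p1] := p01.
have /andP[jp pj] : j%:R <= M * p < j.+1%:R by apply: truncn_itv; rewrite mulr_ge0// ltW.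
have gridE : grid j = j%:R / M.
  by apply/min_idPl; rewrite ler_pdivrMr// mul1r (le_trans jp)// ler_piMr// ltW.
have near_grid : `|p - grid j| <= M^-1.
  rewrite gridE ger0_norm; last by rewrite subr_ge0 ler_pdivrMr// mulrC.
  rewrite lerBlDr [leRHS]addrC -[X in _ + X]mul1r -mulrDl ler_pdivlMr//.
  by rewrite mulrC natr1 ltW.
have Sg : cost_pairs k z (cost_pair (tab (z, j)).1 z (tab (z, j)).2).
  by exists (tab (z, j)).1, (tab (z, j)).2.
have [g1 g2] := cost_pairs_bounds Sg; have [x1 x2] := cost_pairs_bounds Sx.
have A1 := chord_lipschitz g1 g2 near_grid.
have A2 := gP x Sx.
rewrite distrC in near_grid; have A3 := chord_lipschitz x1 x2 near_grid.
move: A1 A2 A3 KM; move: (chord _ p) (chord _ p) (chord _ (grid j)) (chord _ (grid j)).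
by move: (_ * M^-1) => u c1 c2 c3 c4; lra.
Qed.

(** * Backward induction *)

Section Optimality.
Variable th : coordinator_policy E.
Hypothesis measurable_th : measurable_policy th.

(** The action u is the best one with belief p and messages z; continuing is
    called best when some continuation is at least as good as both decisions. *)
Definition optimal_action k z (p : R) (u : option bool) : Prop :=
  if u is Some b then stop_optimal J b (cost_pairs k z) p
  else exists2 x, cost_pairs k z x & forall b, chord x p <= chord (stop_chord J b) p.

Hypothesis th_optimal : forall k z (y : k.-tuple (E ord0)), (0 < k <= T0)%N ->
  0 <= @pi k y z <= 1 -> optimal_action k z (@pi k y z) (@th k y z).

Definition then_policy k (g g' : coordinator_policy E) : coordinator_policy E :=
  fun t => if (t <= k)%N then g t else g' t.

Lemma measurable_then_policy k g g' : measurable_policy g ->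
  measurable_policy g' -> measurable_policy (then_policy k g g').
Proof.
move=> mg mg' t z u t0; rewrite /then_policy.
by case: ifP => _; [exact: mg|exact: mg'].
Qed.

Lemma expected_stage_costE g k w : 0 <= belief_at k w <= 1 ->
  expected_stage_cost g k w =
    chord (if g k (obs Y ord0 k w) (Z k w) is Some b then stop_chord J b
           else cost_pair g (Z k w) (obs Y ord0 k w)) (belief_at k w).
Proof.
move=> p01; rewrite /expected_stage_cost /weighted_cost !posteriorE//.
by rewrite /chord /stage_cost; case: (g k _ _).
Qed.

Lemma cost_pair_then_policy g k z (y : k.-tuple (E ord0)) :
  cost_pair (then_policy k th g) z y = cost_pair g z y.
Proof.
rewrite /cost_pair /conditional_cost.
suff E1 h w : spliced_cost h (then_policy k th g) y w = spliced_cost h g y w.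
  by congr (_, _); case: ifP => // _; congr (fine _ / _);
    apply: eq_integral => w _; rewrite E1.
congr (_ + run_cost _ _ _ _); apply/eq_in_map => t.
by rewrite mem_iota => /andP[kt _]; rewrite /spliced_decision /then_policy leqNgt kt.
Qed.

(** The pointwise comparison: th takes the best action at time k, and the cost of
    continuing with g is within e of the infimum. *)
Lemma then_policy_expected_le g g' k e w : (0 < k <= T0)%N ->
  measurable_policy g' ->
  (forall z (y : k.-tuple (E ord0)),
    0 <= @pi k y z <= 1 -> forall x, cost_pairs k z x ->
    chord (cost_pair g z y) (@pi k y z) <= chord x (@pi k y z) + e) ->
  0 <= e -> 0 <= belief_at k w <= 1 ->
  expected_stage_cost (then_policy k th g) k w <= expected_stage_cost g' k w + e.
Proof.
move=> kT mg' gP e0 p01; rewrite !expected_stage_costE//.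
rewrite cost_pair_then_policy /then_policy leqnn.
have := th_optimal kT p01; have := gP (Z k w) (obs Y ord0 k w) p01.
rewrite -/(belief_at k w); set p := belief_at k w => {}gP.
have Sg' : cost_pairs k (Z k w) (cost_pair g' (Z k w) (obs Y ord0 k w)).
  by exists g', (obs Y ord0 k w).
case: (@th _ _ _) => [b [b_stop b_cont]|[x Sx x_stop]].
  case: (g' _ _ _) => [b'|]; rewrite (@le_trans _ _ (chord (stop_chord J b) p)) ?lexx//.
  - by rewrite (le_trans (b_stop b'))// lerDl.
  - by rewrite (le_trans (b_cont _ Sg'))// lerDl.
case: (g' _ _ _) => [b'|].
  by rewrite (le_trans (gP x Sx))// lerD2r.
exact: gP.
Qed.

(** What is known at time k is still known at time k + 1. *)
Lemma history_set_prefix k (B : messages n -> set (k.-tuple (E ord0))) :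
  history_set (k := k.+1) (fun z => (fun y : k.+1.-tuple (E ord0) => prefix k y) @^-1`
    B (restrict_messages k z)) = history_set B.
Proof.
apply/funext => w; rewrite /history_set /preimage /mkset restrict_received//.
by rewrite -(splice_obs Y k k.+1 w) prefix_splice.
Qed.

(** Where th continues at time k, which is an event known at time k + 1, the
    induction hypothesis applies; where it stops, both policies cost the same. *)
Lemma optimal_first_step k (B : messages n -> set (k.-tuple (E ord0))) g :
  (0 < k <= T0)%N -> measurable_policy g -> (forall z, measurable (B z)) ->
  (forall (B' : messages n -> set (k.+1.-tuple (E ord0))) g', measurable_policy g' ->
    (forall z, measurable (B' z)) ->
    (\int[P]_(w in history_set B') (cost_from (H w) th k.+1 w)%:E <=
     \int[P]_(w in history_set B') (cost_from (H w) g' k.+1 w)%:E)%E) ->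
  (\int[P]_(w in history_set B) (cost_from (H w) th k w)%:E <=
   \int[P]_(w in history_set B) (cost_from (H w) (then_policy k th g) k w)%:E)%E.
Proof.
move=> /andP[k0 kT] mg mB IH; set g1 := then_policy k th g.
have mg1 : measurable_policy g1 by exact: measurable_then_policy.
have mcost g' k' : measurable_policy g' -> (0 < k')%N ->
    measurable_fun setT (fun w => (cost_from (H w) g' k' w)%:E).
  move=> mg' k'0; apply: (measurable_fun_fibers (f := H)
    (F := fun h w => (cost_from h g' k' w)%:E)).
    by move=> h; exact: measurable_hypothesis.
  by move=> h; apply/measurable_EFinP; exact: measurable_cost_from.
have cost0 g' k' w : (0 <= (cost_from (H w) g' k' w)%:E)%E.
  by rewrite lee_fin cost_from_ge0.
pose N_ z : set (k.-tuple (E ord0)) := [set y | @th k y z = None].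
have mN z : measurable (N_ z) by exact: measurable_th.
pose B1 z := B z `&` ~` N_ z.
pose B2 z := B z `&` N_ z.
have mB1 z : measurable (B1 z) by apply: measurableI => //; exact: measurableC.
have mB2 z : measurable (B2 z) by exact: measurableI.
have BE : history_set B = history_set B1 `|` history_set B2.
  apply/seteqP; split => w; rewrite /history_set /=.
    by move=> Bw; have [?|?] := pselect (N_ (Z k w) (obs Y ord0 k w)); [right|left].
  by move=> [[]|[]].
have dB : [disjoint history_set B1 & history_set B2].
  by apply/disj_setPS => w [[_ nN] [_ N']]; exact: nN.
have mE1 := measurable_history_set mB1; have mE2 := measurable_history_set mB2.
have dec1 w : decision Y T Gamma g1 k w = decision Y T Gamma th k w.
  by rewrite /decision /g1 /then_policy leqnn.
rewrite BE !ge0_integral_setU//; try exact/measurable_funTS/mcost.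
apply: leeD.
  rewrite le_eqVlt; apply/orP; left; apply/eqP; apply: eq_integral => w.
  rewrite inE => -[_ nN]; rewrite (cost_fromS _ th)// (cost_fromS _ g1)// dec1.
  rewrite /decision; move: nN; rewrite /N_ /=; by case: (@th _ _ _).
have contE g' : measurable_policy g' ->
    (forall w, decision Y T Gamma g' k w = decision Y T Gamma th k w) ->
    (\int[P]_(w in history_set B2) (cost_from (H w) g' k w)%:E =
     \int[P]_(w in history_set B2) c0%:E +
     \int[P]_(w in history_set B2) (cost_from (H w) g' k.+1 w)%:E)%E.
  move=> mg' dec; rewrite -ge0_integralD//; first last.
  - exact/measurable_funTS/mcost.
  apply: eq_integral => w; rewrite inE => -[_ Nw].
  by rewrite cost_fromS// dec /decision Nw.
rewrite (contE th)// (contE g1)//; apply: leeD => //.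
rewrite -(history_set_prefix B2); apply: IH => // z.
by rewrite -[X in measurable X]setTI; apply: measurable_prefix.
Qed.

(** A policy that takes a best action at each time and belief is optimal from each
    time on, on every event known at that time. Beyond the horizon there is nothing
    left to compare. *)
Lemma stagewise_optimal_from k (B : messages n -> set (k.-tuple (E ord0))) g :
  (0 < k <= T0.+1)%N -> measurable_policy g -> (forall z, measurable (B z)) ->
  (\int[P]_(w in history_set B) (cost_from (H w) th k w)%:E <=
   \int[P]_(w in history_set B) (cost_from (H w) g k w)%:E)%E.
Proof.
move=> /andP[k0 kT]; have [m km] : exists m, (k + m)%N = T0.+1.
  by exists (T0.+1 - k)%N; rewrite subnKC.
elim: m k k0 kT km B g => [|m IHm] k k0 kT km B g mg mB.
  by rewrite /cost_from; move: km; rewrite addn0 => <-; rewrite subnn.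
have kT0 : (k <= T0)%N by rewrite -ltnS -km addnS ltnS leq_addr.
have kT' : (0 < k <= T0)%N by rewrite k0.
have mE := measurable_history_set mB.
apply/lee_addgt0Pr => e e0.
have [gs mgs gsP] := near_optimal_policy k0 e0.
apply: (le_trans (optimal_first_step (g := gs) kT' mgs mB _)).
  by move=> B' g' mg' mB'; apply: IHm; rewrite // -km addnS.
have mg1 : measurable_policy (then_policy k th gs) by exact: measurable_then_policy.
rewrite !integral_cost_from//.
have mstage g' : measurable_policy g' ->
    measurable_fun setT (fun w => (expected_stage_cost g' k w)%:E).
  move=> mg'; apply/measurable_EFinP.
  by apply: measurable_funD; exact: measurable_weighted_cost.
have stage0 g' w : measurable_policy g' -> (0 <= (expected_stage_cost g' k w)%:E)%E.
  by move=> mg'; rewrite lee_fin addr_ge0 ?weighted_cost_ge0.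
apply: (@le_trans _ _ (\int[P]_(w in history_set B)
    ((expected_stage_cost g k w)%:E + e%:E))%E).
  apply: ae_ge0_le_integral => //.
  - by move=> w _; exact: stage0.
  - by apply: measurable_funTS; exact: mstage.
  - by move=> w _; rewrite adde_ge0 ?stage0// lee_fin ltW.
  - by apply: measurable_funTS; apply: emeasurable_funD => //; exact: mstage.
  - apply: filterS (belief_range k0) => w w01 _; rewrite -EFinD lee_fin.
    exact: then_policy_expected_le (ltW e0) w01.
rewrite ge0_integralD//; last 3 first.
- by move=> w _; exact: stage0.
- by apply: measurable_funTS; exact: mstage.
- by move=> w _; rewrite lee_fin ltW.
apply: leeD => //; rewrite integral_cst//.
rewrite -[leRHS]mule1; apply: lee_wpmul2l; first by rewrite lee_fin ltW.
exact: probability_le1.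
Qed.

End Optimality.

(** * The threshold policy *)

Section ThresholdPolicy.
Hypothesis T0_gt0 : (0 < T0)%N.
Hypothesis J01_gt_J11 : J true true < J false true.
Hypothesis J10_gt_J00 : J false false < J true false.
Variables (alpha beta : nat -> messages n -> R).
Hypothesis thresholds : forall k z, (0 < k < T0)%N -> forall p, 0 <= p <= 1 ->
  (p <= alpha k z <-> stop_optimal J true (cost_pairs k z) p) /\
  (beta k z <= p <-> stop_optimal J false (cost_pairs k z) p).

Let th : coordinator_policy E :=
  threshold_policy pi T0 (terminal_threshold J) alpha beta.

Lemma measurable_threshold_policy : measurable_policy th.
Proof.
move=> t z u t0; have [mpi _ _] := pi_belief t0.
suff : fiber_measurable (fun y : t.-tuple (E ord0) => th y z) by exact.
rewrite /th /threshold_policy; case tT : (t < T0)%N; last first.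
  apply: fiber_measurable_if; [|exact: fiber_measurable_cst..].
  exact: measurable_fun_ler.
apply: fiber_measurable_if; [|exact: fiber_measurable_cst|].
  exact: measurable_fun_ler.
apply: fiber_measurable_if; [|exact: fiber_measurable_cst..].
exact: measurable_fun_ltr.
Qed.

(** Strictly between the thresholds neither decision is optimal, so some
    continuation beats the better of the two, hence both. *)
Lemma threshold_policy_optimal_action k z (y : k.-tuple (E ord0)) :
  (0 < k <= T0)%N -> 0 <= @pi k y z <= 1 ->
  optimal_action k z (@pi k y z) (@th k y z).
Proof.
move=> /andP[k0 kT] p01; rewrite /th /threshold_policy.
set p := @pi k y z in p01 *; case: ltnP => kT0; last first.
  have kE : k = T0 by apply/eqP; rewrite eqn_leq kT kT0.
  have term x : cost_pairs k z x -> chord (stop_chord J false) p <= chord x p.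
    by move: (k) kE x => _ -> x; exact: cost_pairs_terminal.
  case: ifP => [pa|/negbT]; last first.
    rewrite -ltNge => /ltW ap; split => // -[|]//.
    by rewrite stop_false_le_true.
  have tf : chord (stop_chord J true) p <= chord (stop_chord J false) p.
    by rewrite stop_true_le_false.
  by split => [[|]//|x /term]; exact: le_trans.
have kT0' : (0 < k < T0)%N by rewrite k0.
have [aP bP] := @thresholds k z kT0' p p01.
case: ifP => [/aP//|/negbT pa]; case: ifP => [pb|/negbT]; last first.
  by rewrite -leNgt => /bP.
have [b b_stop] := exists_stop_le J p.
have nb : ~ stop_optimal J b (cost_pairs k z) p.
  case: b {b_stop}; first by move/aP; apply/negP.
  by move/bP; apply/negP; rewrite -ltNge.
have [x Sx xb] : exists2 x, cost_pairs k z x & chord x p < chord (stop_chord J b) p.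
  apply: contrapT => nx; apply: nb; split => // x Sx.
  by rewrite leNgt; apply/negP => xb; apply: nx; exists x.
by exists x => // b'; exact: le_trans (ltW xb) (b_stop b').
Qed.

Lemma threshold_policy_admissible : coordinator_admissible Y T Gamma th.
Proof.
split; first exact: measurable_threshold_policy.
move=> w; rewrite /tau0 /first_time -[X in (_ < X)%N](size_iota 1) -has_find.
apply/hasP; exists T0; first by rewrite mem_iota T0_gt0 add1n leqnn.
by rewrite /decision /th /threshold_policy ltnn; case: ifP.
Qed.

(** The criterion of the problem counts the first time unit, which [cost_from]
    starts after. *)
Lemma stopping_costE g w : (tau0 Y T Gamma g w <= T0)%N ->
  c0 * (tau0 Y T Gamma g w)%:R +
    J (odflt false (decision Y T Gamma g (tau0 Y T Gamma g w) w)) (H w) =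
  c0 + cost_from (H w) g 1 w.
Proof.
pose u t := decision Y T Gamma g t w.
have -> : tau0 Y T Gamma g w = (find (fun t => isSome (u t)) (iota 1 T0)).+1 by [].
rewrite /cost_from subn1 /= -[decision _ _ _ _ _ _]/(u _).
rewrite -[X in run_cost _ _ _ X]/[seq u t | t <- iota 1 T0] => found.
have -> : u (find (fun t => isSome (u t)) (iota 1 T0)).+1 =
    nth None [seq u t | t <- iota 1 T0] (find isSome [seq u t | t <- iota 1 T0]).
  by rewrite find_map (nth_map 0%N) ?size_iota// nth_iota.
rewrite -(find_map u isSome).
have : has isSome [seq u t | t <- iota 1 T0].
  by rewrite has_map has_find size_iota.
elim: [seq u t | t <- iota 1 T0] => //= -[b|] s IHs /=; first by rewrite mulr1.
by move=> /IHs <-; rewrite -natr1 mulrDr mulr1 addrAC addrC addrA.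
Qed.

Lemma threshold_policy_coordinator_optimal (c : 'I_n.+1 -> R) :
  c ord0 = c0 -> (forall i, 0 <= c i) ->
  coordinator_optimal P H Y T Gamma c J th.
Proof.
move=> cE c_ge0; split; first exact: threshold_policy_admissible.
move=> g [mg g_adm].
have mth := measurable_threshold_policy; have [_ th_adm] := threshold_policy_admissible.
pose K w := c0 + \sum_(j < n) c (lift ord0 j) * (tau Y T Gamma j w)%:R.
have K0 w : 0 <= K w by rewrite addr_ge0// sumr_ge0// => j _; rewrite mulr_ge0.
have mK : measurable_fun setT K.
  apply: measurable_funD => //; apply: measurable_sum => j.
  apply: measurable_funM => //.
  apply: (measurable_fun_fibers (f := tau Y T Gamma j)
    (F := fun (t : nat) (_ : Omega) => t%:R : R)) => //.
  exact: tau_measurable TN Gamma_adm j.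
have costE g' : (forall w, (tau0 Y T Gamma g' w <= T0)%N) ->
    measurable_policy g' ->
    (total_cost P H Y T Gamma c J g' =
     \int[P]_w (K w)%:E + \int[P]_w (cost_from (H w) g' 1 w)%:E)%E.
  move=> g'_adm mg'; rewrite -ge0_integralD//; last 4 first.
  - by move=> w _; rewrite lee_fin.
  - exact/measurable_EFinP.
  - by move=> w _; rewrite lee_fin cost_from_ge0.
  - apply: (measurable_fun_fibers (f := H) (F := fun h w => (cost_from h g' 1 w)%:E)).
      by move=> h; exact: measurable_hypothesis.
    by move=> h; apply/measurable_EFinP; exact: measurable_cost_from.
  rewrite /total_cost unlock; apply: eq_integral => w _.
  by rewrite -EFinD; congr (_%:E); rewrite cE addrAC stopping_costE// /K addrAC.
rewrite !costE//; apply: leeD => //.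
have := @stagewise_optimal_from th mth threshold_policy_optimal_action 1 (fun=> setT) g.
rewrite (_ : history_set _ = setT); last by apply/seteqP; split.
by apply.
Qed.

End ThresholdPolicy.
End Belief.

End Conditioning.

Theorem theorem12 (R : realType)
  (d : measure_display) (Omega : measurableType d) (P : probability Omega R)
  (H : {mfun Omega >-> bool}) (p0 : R)
  (n : nat) (dE : 'I_n.+1 -> measure_display)
  (E : forall i, measurableType (dE i))
  (mu : forall i, {sigma_finite_measure set (E i) -> \bar R})
  (Y : forall i, nat -> {mfun Omega >-> E i})
  (T : 'I_n.+1 -> nat)
  (c : 'I_n.+1 -> R) (J : bool -> bool -> R) (L : R)
  (Gamma : forall j, peripheral_policy E j)
  (prior : P [set w | H w = false] = p0%:E)
  (laws : discrete_or_density P H Y mu)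
  (indep_sensors : cond_indep_sensors P H Y)
  (indep_times : cond_indep_times P H Y)
  (T_gt0 : forall i, (0 < T i)%N)
  (c_gt0 : forall i, 0 < c i)
  (J_bounds : forall u h, 0 <= J u h <= L)
  (J01_gt_J11 : J true true < J false true)
  (J10_gt_J00 : J false false < J true false)
  (Gamma_adm : peripheral_admissible Y T Gamma) :
  exists (aT : R) (alpha beta : nat -> messages n -> R),
    [/\ 0 <= aT <= 1,
        forall k z, (0 < k < T ord0)%N ->
          [/\ 0 <= alpha k z, alpha k z <= beta k z & beta k z <= 1] &
        forall pi : belief_map E R, is_belief P H Y T Gamma pi ->
          coordinator_optimal P H Y T Gamma c J
            (threshold_policy pi (T ord0) aT alpha beta)].
Proof.
pose N := (\max_(i < n.+1) T i)%N.
have TN i : (T i <= N)%N by exact: leq_bigmax.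
have c0_ge0 := ltW (c_gt0 ord0).
have /choice[ab abP] (kz : nat * messages n) := stopping_thresholds
  J01_gt_J11 J10_gt_J00 (fun x => @cost_pairs_ge _ _ _ P H _ _ _ _ _ _ _ TN Gamma_adm
    _ _ _ c0_ge0 J_bounds kz.1 kz.2 x (ltW J01_gt_J11) (ltW J10_gt_J00)).
exists (terminal_threshold J), (fun k z => (ab (k, z)).1), (fun k z => (ab (k, z)).2).
split.
- exact: terminal_threshold_bounds.
- by move=> k z _; have [a0 le_ab b1 _] := abP (k, z).
move=> pi pi_belief.
apply: (threshold_policy_coordinator_optimal TN Gamma_adm indep_sensors indep_times
  c0_ge0 J_bounds pi_belief) => //.
- by move=> k z _ p p01; have [_ _ _ abE] := abP (k, z); exact: abE.
- by move=> i; exact: ltW.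
Qed.
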